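(* Let $E$ be a locally complete locally convex space whose separable bounded sets are metrizable. Then for a bounded subset $A$ of $E$, the following assertions are equivalent: (i) $A$ is a coarse $1$-limited set; (ii) $A$ does not contain an $\ell_1$-sequence $\{x_n\}_{n\in\omega}$ such that the closed span $\overline{\mathrm{span}}\{x_n\}_{n\in\omega}$ is complemented in $E$. If in addition $E$ is barrelled, then (i) and (ii) are equivalent to (iii) $A$ is a $(1,\infty)$-limited set.
   Context: All locally convex spaces are Hausdorff, over $\mathbb{F}\in\{\mathbb{R},\mathbb{C}\}$; $\omega=\{0,1,2,\dots\}$; $A$ is non-empty. $E'$ is the topological dual of $E$. $E$ is locally complete if the closed absolutely convex hull of each null sequence in $E$ is compact; barrelled if every $\sigma(E',E)$-bounded subset of $E'$ is equicontinuous. A subspace is complemented in $E$ if it is the range of a continuous linear projection of $E$. A sequence $\{x_n\}_{n\in\omega}$ in $E$ is an $\ell_1$-sequence if there is a linear topological isomorphism $R$ from $\overline{\mathrm{span}}\{x_n\}_{n\in\omega}$ onto a subspace of $\ell_1$ such that $R(x_n)=e_n$ for every $n\in\omega$, where $\{e_n\}$ is the canonical basis of $\ell_1$. A non-empty subset $A$ of $E$ is coarse $1$-limited if $T(A)$ is relatively compact for every continuous linear map $T:E\to\ell_1$. $A$ is $(1,\infty)$-limited if $\sup_{a\in A}|\langle\chi_n,a\rangle|\to0$ for every sequence $\{\chi_n\}_{n\in\omega}$ in $E'$ such that $(\langle\chi_n,x\rangle)_n\in\ell_1$ for every $x\in E$. *)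

(* Defs.v *)
From HB Require Import structures.
From mathcomp Require Import all_boot all_order all_algebra.
From mathcomp Require Import complex.
From mathcomp Require Import all_classical all_reals all_analysis.

Set Implicit Arguments.
Unset Strict Implicit.
Unset Printing Implicit Defensive.

Import Order.TTheory GRing.Theory Num.Theory.
Import numFieldNormedType.Exports.

Local Open Scope classical_set_scope.
Local Open Scope ring_scope.

Variant scalar_kind := RealScalars | ComplexScalars.

Definition scalars (R : realType) (F : scalar_kind) : numFieldType :=
  match F with RealScalars => R | ComplexScalars => complex R end.

(* In a [numFieldType] the norm [`|z|] is an element of the field itself;
   [scalar_abs z] is the same number in [R], so that suprema can be taken. *)
Definition scalar_abs (R : realType) (F : scalar_kind) : scalars R F -> R :=
  match F with
  | RealScalars => fun z : R => `|z|
  | ComplexScalars => fun z : complex R => complex.Re `|z|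
  end.

Section LocallyConvexSpaces.
Context {K : numFieldType}.

Definition continuous_linear (V W : tvsType K) : set (V -> W) :=
  [set f | linear f /\ continuous f].
Arguments continuous_linear : clear implicits.

Definition topological_dual (E : tvsType K) : set (E -> K^o) :=
  continuous_linear E K^o.
Arguments topological_dual : clear implicits.

Definition bounded_wrt (V : lmodType K) (nbhs0 : set_system V) (A : set V) :=
  forall U, nbhs0 U ->
    exists2 s : K, 0 < s & forall t : K, s < t -> A `<=` [set t *: x | x in U].

Definition tvs_bounded (E : tvsType K) (A : set E) : Prop :=
  bounded_wrt (nbhs (0 : E)) A.

Definition weak_star_nbhs0 (E : tvsType K) : set_system (E -> K^o) :=
  [set U | exists (s : seq E) (e : K),
    0 < e /\ [set f | forall x, x \in s -> `|f x| < e] `<=` U].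

(* sigma(E', E) is induced by the product topology of [E -> K], so boundedness
   of a subset of E' may be tested in the whole function space. *)
Definition weak_star_bounded (E : tvsType K) (B : set (E -> K^o)) : Prop :=
  bounded_wrt (@weak_star_nbhs0 E) B.

Definition absolutely_convex (E : lmodType K) (A : set E) : Prop :=
  forall (x y : E) (a b : K), A x -> A y -> `|a| + `|b| <= 1 ->
    A (a *: x + b *: y).

Definition closed_absconvex_hull (E : tvsType K) (A : set E) : set E :=
  closure (smallest (@absolutely_convex E) A).

Definition locally_complete (E : tvsType K) : Prop :=
  forall x : nat -> E, x @ \oo --> (0 : E) ->
    compact (closed_absconvex_hull (range x)).

Definition barrelled (E : tvsType K) : Prop :=
  forall B : set (E -> K^o), B `<=` topological_dual E ->
    weak_star_bounded B -> equicontinuous B id.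

Definition is_subspace (E : lmodType K) (L : set E) : Prop :=
  L 0 /\ forall (a : K) (x y : E), L x -> L y -> L (a *: x + y).

Definition closed_span (E : tvsType K) (A : set E) : set E :=
  closure (smallest (@is_subspace E) A).

Definition complemented (E : tvsType K) (L : set E) : Prop :=
  exists P : E -> E,
    [/\ continuous_linear E E P, P \o P = P & range P = L].

(* A map [T], of which only the restriction to [L] matters, that induces a
   linear homeomorphism from the subspace [L] onto its image. *)
Definition linear_embedding_on (E G : tvsType K) (L : set E) (T : E -> G) :=
  [/\ forall (a : K) (x y : E), L x -> L y -> T (a *: x + y) = a *: T x + T y,
      {within L, continuous T}
    & exists S : G -> E, (forall x, L x -> S (T x) = x) /\
                         {within T @` L, continuous S}].

Definition abs_summable (x : nat -> K^o) : Prop :=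
  cvgn (series (fun n => `|x n| : K^o)).

End LocallyConvexSpaces.
Arguments continuous_linear {K} V W.
Arguments topological_dual {K} E.


Definition separable (X : topologicalType) : Prop :=
  exists2 D : set X, countable D & dense D.

Definition metrizable (R : realType) (X : topologicalType) : Prop :=
  exists (M : metricType R) (f : X -> M) (g : M -> X),
    [/\ cancel f g, cancel g f, continuous f & continuous g].

Section nonneg_limits.
Context {K : numFieldType}.
Implicit Types u v : nat -> K^o.

Lemma cvg_ge0 u (l : K^o) : (forall n, 0 <= u n) -> u @ \oo --> l -> 0 <= l.
Proof.
move=> u0 ul.
suff -> : l = `|l| by [].
apply: (@cvg_unique _ (@norm_hausdorff K K^o) (u @ \oo)) => //.
have -> : u = (fun n => `|u n|) by apply/funext => n; rewrite ger0_norm.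
exact: (@cvg_norm _ K^o).
Qed.

Lemma cvg_le_norm u v (l m : K^o) : (forall n, u n <= v n) ->
  u @ \oo --> l -> v @ \oo --> m -> l <= m.
Proof.
move=> uv ul vm; rewrite -subr_ge0.
apply: (@cvg_ge0 (fun n => v n - u n)); first by move=> n; rewrite subr_ge0.
exact: (@cvgB _ K^o).
Qed.

Lemma nondecreasing_le_limit u (l : K^o) : nondecreasing_seq u ->
  u @ \oo --> l -> forall n, u n <= l.
Proof.
move=> ndu ul n.
have ul' : u (k + n)%N @[k --> \oo] --> l by rewrite (cvg_shiftn n u).
apply: (@cvg_le_norm (fun=> u n) _ _ _ _ (cvg_cst (u n)) ul').
by move=> k; apply: ndu; rewrite leq_addl.
Qed.

End nonneg_limits.

Section monotone_convergence.
Context {R : realType}.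

Let normC_real (z : complex R) : 0 <= z -> z = (complex.Re z)%:C%C.
Proof. by case: z => a b; rewrite lecE /= => /andP[/eqP -> _]. Qed.

Lemma nondecreasing_cvg_scalars (F : scalar_kind) (u : nat -> (scalars R F)^o)
    (M : scalars R F) : (forall n, 0 <= u n) -> nondecreasing_seq u ->
  (forall n, u n <= M) -> cvgn u.
Proof.
case: F u M => /= u M u0 ndu uM.
  apply: (@nondecreasing_is_cvgn R u) => //.
  by exists M => _ [n _ <-].
pose v n := complex.Re (u n).
have uE n : u n = (v n)%:C%C by exact: normC_real.
have ndv : nondecreasing_seq v.
  by move=> m n mn; move: (ndu _ _ mn); rewrite !uE lecR.
have vM : has_ubound (range v).
  exists (complex.Re M) => _ [n _ <-].
  by move: (uM n); rewrite lecE => /andP[].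
have /cvg_ex[/= l vl] := nondecreasing_is_cvgn ndv vM.
apply/cvg_ex; exists (l%:C%C : (complex R)^o).
apply/cvgrPdist_lt => /= e e0.
have eE : e = (complex.Re e)%:C%C by apply: normC_real; exact: ltW.
have e0' : 0 < complex.Re e by move: e0; rewrite {1}eE ltcR.
move/cvgrPdist_lt : vl => /(_ _ e0').
apply: filterS => n /=.
rewrite uE -rmorphB normc_def /= expr0n addr0 sqrtr_sqr => h.
by rewrite eE ltcR.
Qed.

End monotone_convergence.

Section ell1.
Context {R : realType} {F : scalar_kind}.
Local Notation K := (scalars R F).
Implicit Types x y : nat -> K^o.

Let psum_ge0 x n : 0 <= series (fun n => `|x n| : K^o) n.
Proof. by rewrite /series /=; apply: sumr_ge0 => i _; exact: normr_ge0. Qed.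

Let psum_nd x : nondecreasing_seq (series (fun n => `|x n| : K^o)).
Proof.
apply/nondecreasing_seqP => n.
by rewrite /series /= big_nat_recr //= lerDl normr_ge0.
Qed.

Lemma abs_summable_bounded x (M : K) :
  (forall n, series (fun n => `|x n| : K^o) n <= M) -> abs_summable x.
Proof. exact: nondecreasing_cvg_scalars. Qed.

Lemma psum_le_lim x n : abs_summable x ->
  series (fun n => `|x n| : K^o) n <= limn (series (fun n => `|x n| : K^o)).
Proof. by move=> cx; apply: nondecreasing_le_limit => //; exact: psum_nd. Qed.

Let psumD x y n : series (fun n => `|(x + y) n| : K^o) n <=
  series (fun n => `|x n| : K^o) n + series (fun n => `|y n| : K^o) n.
Proof.
rewrite /series /= -big_split /=; apply: ler_sum => i _; exact: ler_normD.
Qed.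

Let psumZ (a : K) x n : series (fun n => `|(a *: x) n| : K^o) n =
  `|a| * series (fun n => `|x n| : K^o) n.
Proof.
by rewrite /series /= mulr_sumr; apply: eq_bigr => i _; rewrite -normrM.
Qed.

Lemma abs_summableD x y :
  abs_summable x -> abs_summable y -> abs_summable (x + y).
Proof.
move=> cx cy; apply: (@abs_summable_bounded _
  (limn (series (fun n => `|x n| : K^o)) +
   limn (series (fun n => `|y n| : K^o)))) => n.
by apply: le_trans (psumD _ _ _) _; apply: lerD; exact: psum_le_lim.
Qed.

Lemma abs_summableZ (a : K) x : abs_summable x -> abs_summable (a *: x).
Proof.
move=> cx; apply: (@abs_summable_bounded _
  (`|a| * limn (series (fun n => `|x n| : K^o)))) => n.
by rewrite psumZ ler_wpM2l //; exact: psum_le_lim.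
Qed.

Lemma abs_summable_finsupp x N : (forall n, (N <= n)%N -> x n = 0) ->
  abs_summable x.
Proof.
move=> x0; apply: (@abs_summable_bounded _ (series (fun n => `|x n| : K^o) N)).
move=> n; have [nN|/ltnW Nn] := leqP n N; first exact: psum_nd.
rewrite le_eqVlt; apply/orP; left.
rewrite /series /= (@big_cat_nat _ _ _ N) //= [X in _ + X]big1_seq ?addr0 //.
by move=> i /andP[_]; rewrite mem_index_iota => /andP[Ni _]; rewrite x0 ?normr0.
Qed.

Definition l1_pred : {pred nat -> K^o} := mem [set x | abs_summable x].

Record l1 := L1 { l1_val :> nat -> K^o ; _ : l1_val \in l1_pred }.

HB.instance Definition _ := [isSub for l1_val].
HB.instance Definition _ := [Choice of l1 by <:].

Lemma l1_submod_closed : submod_closed l1_pred.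
Proof.
split; first by rewrite inE /=; apply: (@abs_summable_finsupp _ 0).
move=> a x y; rewrite !inE /= => sx sy.
by apply: abs_summableD => //; exact: abs_summableZ.
Qed.
HB.instance Definition _ := GRing.isSubmodClosed.Build _ _ l1_pred
  l1_submod_closed.
HB.instance Definition _ := [SubChoice_isSubLmodule of l1 by <:].

Lemma l1P (x : l1) : abs_summable x.
Proof. by have := valP x; rewrite inE. Qed.
Arguments l1P x : clear implicits.

Definition l1_norm (x : l1) : K := limn (series (fun n => `|x n| : K^o)).

Let l1_norm_ub (x : l1) (M : K) :
  (forall n, series (fun n => `|x n| : K^o) n <= M) -> l1_norm x <= M.
Proof.
move=> h.
by apply: (@cvg_le_norm K (series (fun n => `|x n| : K^o)) (fun=> M)) => //;
  [exact: (l1P x)|exact: cvg_cst].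
Qed.

Let l1_normD (x y : l1) : l1_norm (x + y) <= l1_norm x + l1_norm y.
Proof.
apply: l1_norm_ub => n; apply: le_trans (psumD _ _ _) _.
by apply: lerD; apply: psum_le_lim; exact: l1P.
Qed.

Let l1_normZ (a : K) (x : l1) : l1_norm (a *: x) = `|a| * l1_norm x.
Proof.
apply: (@cvg_lim K^o); first exact: (@norm_hausdorff K K^o).
rewrite (_ : series _ = fun n => `|a| *: series (fun n => `|x n| : K^o) n).
  by apply: cvgZr; exact: l1P.
by apply/funext => n; exact: psumZ.
Qed.

Let l1_norm0_eq0 (x : l1) : l1_norm x = 0 -> x = 0.
Proof.
move=> x0; apply/val_inj/funext => n /=; apply/normr0_eq0/le_anti.
rewrite normr_ge0 andbT -x0; apply: le_trans (psum_le_lim n.+1 (l1P x)).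
by rewrite /series /= big_nat_recr //= lerDr; exact: psum_ge0.
Qed.

HB.instance Definition _ := @Lmodule_isNormed.Build K l1 l1_norm
  l1_normD l1_normZ l1_norm0_eq0.

Fact l1_unit_subproof (n : nat) : (fun k => (k == n)%:R : K^o) \in l1_pred.
Proof.
rewrite inE /=; apply: (@abs_summable_finsupp _ n.+1) => k nk.
by rewrite gtn_eqF.
Qed.
Definition l1_unit (n : nat) : l1 := L1 (l1_unit_subproof n).

End ell1.
Arguments l1 : clear implicits.

Section limitedness.
Context {R : realType} {F : scalar_kind}.
Local Notation K := (scalars R F).
Variable E : tvsType K.

Definition l1_sequence (x : nat -> E) : Prop :=
  exists2 T : E -> l1 R F,
    linear_embedding_on (closed_span (range x)) T &
    forall n, T (x n) = l1_unit n.

Definition coarse_1_limited (A : set E) : Prop :=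
  forall T : E -> l1 R F, continuous_linear E (l1 R F) T ->
    precompact (T @` A).

Definition one_infty_limited (A : set E) : Prop :=
  forall chi : nat -> E -> K^o, (forall n, topological_dual E (chi n)) ->
    (forall x, abs_summable (fun n => chi n x)) ->
    ereal_sup [set (scalar_abs (chi n a))%:E | a in A] @[n --> \oo] --> 0%E.

End limitedness.

(* Main.v *)
From HB Require Import structures.
Require Import Defs.
From mathcomp Require Import all_boot all_order all_algebra.
From mathcomp Require Import complex.
From mathcomp Require Import all_classical all_reals all_analysis.
From mathcomp Require Import ring lra.

Set Implicit Arguments.
Unset Strict Implicit.
Unset Printing Implicit Defensive.

Import Order.TTheory GRing.Theory Num.Theory.
Import numFieldNormedType.Exports.

Local Open Scope classical_set_scope.
Local Open Scope ring_scope.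

(** The implication from (i) to (ii) is soft: if x is an l_1-sequence in A with
    embedding T and P projects E onto its closed span, then T o P maps E
    continuously into l_1 and sends x_n to the unit vector e_n, and the unit
    vectors are not relatively compact ([coarse_1_limited_no_l1]).

    Conversely, let T : E -> l_1 be continuous with T(A) not relatively compact.
    A bounded set of l_1 that is not relatively compact contains points whose
    distance to some fixed y stays above some e > 0 while they agree with y, up
    to any prescribed error, on any prescribed initial segment of coordinates
    ([not_precompact_humps]).  A gliding hump then produces a block operator V
    on l_1 and points a_n of A with |V T a_n - e_n| <= 1/2 ([gliding_hump]).
    Local completeness makes S(c) = \sum_n c_n a_n a continuous operator from
    l_1 to E ([synthesis_operator]): writing c_n = b_n d_n with b_n -> 0 and
    (d_n) in the unit ball of l_1, the partial sums lie in the compact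
    absolutely convex hull of the null sequence (b_n a_n).  The operator V T S
    is at distance at most 1/2 from the identity of l_1, hence it is invertible
    ([half_perturbation]), and W = (V T S)^-1 V T is a continuous left inverse
    of S ([almost_units_lift]).  So S o W is a projection of E onto the closed
    span of (a_n), on which W is an isomorphism onto l_1 with W(a_n) = e_n
    ([l1_section_complemented]): this contradicts (ii).

    The coordinates of the same W violate (iii) on the points a_n, so (iii)
    implies (i) ([one_infty_limited_coarse]).  If E is barrelled, a sequence of
    functionals chi_n with (chi_n(x)) in l_1 for every x is the sequence of
    coordinates of a continuous map into l_1 ([barrelled_l1_map]), and on a
    relatively compact subset of l_1 the coordinates tend to 0 uniformly
    ([precompact_coord]): so (i) implies (iii). *)

(** * Real and complex scalars *)

Section scalar_field.
Context {R : realType} {F : scalar_kind}.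
Local Notation K := (scalars R F).
Implicit Types (z w : K) (r s : R).

(** The embedding of R into the scalar field: it lets the estimates be made in R,
    where the order is total. *)
Definition scalar_of_real (r : R) : K :=
  match F return scalars R F with
  | RealScalars => r
  | ComplexScalars => r%:C%C
  end.

Fact scalar_of_real_zmod_morphism : zmod_morphism scalar_of_real.
Proof. by move=> r s; rewrite /scalar_of_real; case: F => //; rewrite rmorphB. Qed.

Fact scalar_of_real_monoid_morphism : monoid_morphism scalar_of_real.
Proof.
by rewrite /scalar_of_real; case: F; split => // r s; rewrite rmorphM.
Qed.

HB.instance Definition _ := GRing.isZmodMorphism.Build R K scalar_of_real
  scalar_of_real_zmod_morphism.
HB.instance Definition _ := GRing.isMonoidMorphism.Build R K scalar_of_real
  scalar_of_real_monoid_morphism.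

Lemma ler_scalar r s : (scalar_of_real r <= scalar_of_real s) = (r <= s).
Proof. by rewrite /scalar_of_real; case: F => //; rewrite lecR. Qed.

Lemma ltr_scalar r s : (scalar_of_real r < scalar_of_real s) = (r < s).
Proof. by rewrite /scalar_of_real; case: F => //; rewrite ltcR. Qed.

Lemma normr_scalar z : `|z| = scalar_of_real (scalar_abs z).
Proof.
by move: z; rewrite /scalar_of_real /scalar_abs; case: F => //= -[a b].
Qed.

Lemma scalar_abs_of_real r : scalar_abs (scalar_of_real r) = `|r|.
Proof.
rewrite /scalar_of_real /scalar_abs; case: F => //=.
by rewrite expr0n addr0 sqrtr_sqr.
Qed.

Lemma scalar_abs_ge0 z : 0 <= scalar_abs z.
Proof. by rewrite -ler_scalar rmorph0 -normr_scalar. Qed.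

Lemma scalar_absD z w : scalar_abs (z + w) <= scalar_abs z + scalar_abs w.
Proof. by rewrite -ler_scalar rmorphD /= -!normr_scalar ler_normD. Qed.

Lemma scalar_absM z w : scalar_abs (z * w) = scalar_abs z * scalar_abs w.
Proof.
by apply/le_anti; rewrite -!ler_scalar rmorphM /= -!normr_scalar normrM lexx.
Qed.

Lemma scalar_absN z : scalar_abs (- z) = scalar_abs z.
Proof. by apply/le_anti; rewrite -!ler_scalar -!normr_scalar normrN lexx. Qed.

Lemma scalar_abs_eq0 z : (scalar_abs z == 0) = (z == 0).
Proof.
by rewrite -[in RHS]normr_eq0 normr_scalar -(rmorph0 scalar_of_real) !eq_le !ler_scalar.
Qed.

Lemma scalar_abs0 : scalar_abs (0 : K) = 0.
Proof. by apply/eqP; rewrite scalar_abs_eq0. Qed.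

Lemma scalar_abs1 : scalar_abs (1 : K) = 1.
Proof. by rewrite -(rmorph1 scalar_of_real) scalar_abs_of_real normr1. Qed.

Lemma scalar_abs_norm z : scalar_abs `|z| = scalar_abs z.
Proof. by rewrite normr_scalar scalar_abs_of_real ger0_norm // scalar_abs_ge0. Qed.

Lemma scalar_abs_sum I (s : seq I) (P : pred I) (f : I -> K) :
  scalar_abs (\sum_(i <- s | P i) f i) <= \sum_(i <- s | P i) scalar_abs (f i).
Proof.
elim/big_rec2 : _ => [|i r z _ zr]; first by rewrite scalar_abs0.
by apply: le_trans (scalar_absD _ _) _; rewrite lerD2l.
Qed.

Lemma gt0_scalarP (e : K) : 0 < e -> exists2 r, 0 < r & e = scalar_of_real r.
Proof.
move=> e0; have eE : e = scalar_of_real (scalar_abs e).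
  by rewrite -normr_scalar gtr0_norm.
by exists (scalar_abs e) => //; rewrite -ltr_scalar -eE rmorph0.
Qed.

Lemma scalar_gt0 r : (0 < scalar_of_real r) = (0 < r).
Proof. by rewrite -[in LHS](rmorph0 scalar_of_real) ltr_scalar. Qed.

Lemma scalar_abs_cvgP T (G : set_system T) (f : T -> K^o) (l : K^o) :
  Filter G ->
  (f @ G --> l) <->
  forall e : R, 0 < e -> \forall t \near G, scalar_abs (l - f t) < e.
Proof.
move=> FG; split => [/cvgrPdist_lt fl e e0|fl].
  have := fl (scalar_of_real e); rewrite scalar_gt0 => /(_ e0).
  by apply: filterS => t; rewrite normr_scalar ltr_scalar.
apply/cvgrPdist_lt => e /gt0_scalarP[r /fl + ->]; apply: filterS => t.
by rewrite normr_scalar ltr_scalar.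
Qed.

End scalar_field.
Arguments scalar_of_real {R} F r.

Section ultra.
Context {R : realType}.

Lemma ultra_bounded_real_cvg T (G : set_system T) (f : T -> R) (M : R) :
  UltraFilter G -> (\forall t \near G, `|f t| <= M) -> exists l : R, f @ G --> l.
Proof.
move=> UG fM; have FG : ProperFilter G by exact: ultra_proper.
have GM : (f @ G) `[- M, M]%classic.
  by apply: filterS fM => t; rewrite ler_norml /= in_itv.
have [l [_ cl]] := @segment_compact R (- M) M (f @ G) _ GM.
exists l => V lV; have [//|GnV] := in_ultra_setVsetC (f @^-1` V) UG.
by case: (cl (~` V) V GnV lV) => s [].
Qed.

(** Closed discs are compact; in the complex case the real and imaginary parts
    converge separately. *)
Lemma ultra_bounded_cvg (F : scalar_kind) T (G : set_system T)
    (f : T -> (scalars R F)^o) (M : R) :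
  UltraFilter G -> (\forall t \near G, scalar_abs (f t) <= M) ->
  exists l : (scalars R F)^o, f @ G --> l.
Proof.
case: F f => /= f UG fM; first exact: ultra_bounded_real_cvg fM.
have FG : ProperFilter G by exact: ultra_proper.
have reM : \forall t \near G, `|complex.Re (f t)| <= M.
  by apply: filterS fM => t; apply: le_trans; rewrite -lecR; exact: normc_ge_Re.
have imM : \forall t \near G, `|complex.Im (f t)| <= M.
  apply: filterS fM => t; apply: le_trans; case: (f t) => a b /=.
  by rewrite -sqrtr_sqr ler_wsqrtr // lerDr sqr_ge0.
have [a fa] := ultra_bounded_real_cvg UG reM.
have [b fb] := ultra_bounded_real_cvg UG imM.
exists ((a +i* b)%C); apply/(@scalar_abs_cvgP R ComplexScalars) => e e0.
have e2 : 0 < e / 2 by rewrite divr_gt0.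
move/cvgrPdist_lt : fa => /(_ _ e2); move/cvgrPdist_lt : fb => /(_ _ e2).
apply: filterS2 => t fb fa.
rewrite -ltcR /=.
suff : `|(a +i* b)%C - f t| < (e%:C)%C. by [].
case: (f t) fb fa => x y /= yb xa.
have -> : (a +i* b)%C - (x +i* y)%C = ((a - x)%:C)%C + (((b - y) *i))%C.
  by apply/eqP; rewrite eq_complex /= !(addr0, add0r) !eqxx.
apply: le_lt_trans (ler_normD _ _) _.
rewrite !normc_def /= !expr0n /= !(addr0, add0r) !sqrtr_sqr.
by rewrite -rmorphD ltcR; lra.
Qed.

End ultra.

(** * Continuous linear maps and the space l_1 *)

Section linear_maps.
Context {K : numFieldType}.

(** Turns the predicate into a bundled linear map, so that the theory of bundled
    maps applies to it. *)
Lemma linear_pack (V W : lmodType K) (f : V -> W) :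
  linear f -> exists g : {linear V -> W}, f = g.
Proof.
move=> lf; pose mf := GRing.isLinear.Build K V W *:%R f lf.
by exists (HB.pack_for {linear V -> W} f mf).
Qed.

Lemma linear_fun_comp (U V W : lmodType K) (f : U -> V) (g : V -> W) :
  linear f -> linear g -> linear (g \o f).
Proof. by move=> lf lg a x y; rewrite /= lf lg. Qed.

Lemma linear_continuous_at0 (V W : tvsType K) (f : V -> W) :
  linear f -> (forall U, nbhs (0 : W) U -> nbhs (0 : V) (f @^-1` U)) ->
  continuous f.
Proof.
move=> lf f0 x U /(nbhsB (- f x)); rewrite addNr => /f0/(nbhsT x).
apply: filterS => _ [v /= [u Uu uv] <-].
have [g fg] := linear_pack lf; rewrite /= fg linearD -fg -uv.
by rewrite addrA subrr add0r.
Qed.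

Lemma continuous_linear_comp (U V W : tvsType K) (f : U -> V) (g : V -> W) :
  continuous_linear U V f -> continuous_linear V W g ->
  continuous_linear U W (g \o f).
Proof.
move=> [lf cf] [lg cg]; split; first exact: linear_fun_comp.
by move=> x; apply: continuous_comp; [exact: cf|exact: cg].
Qed.

End linear_maps.

(** The norm of l_1 as an element of R.  It is locked so that comparing two norms
    does not unfold the limits that define them. *)
HB.lock Definition l1_nrm (R : realType) (F : scalar_kind) (x : l1 R F) : R :=
  scalar_abs (`|x| : scalars R F).

Section ell1_norm.
Context {R : realType} {F : scalar_kind}.
Local Notation K := (scalars R F).
Local Notation L := (l1 R F).
Implicit Types x y : L.

Lemma normr_l1 x : `|x| = scalar_of_real F (l1_nrm x).
Proof. by rewrite l1_nrm.unlock -normr_scalar normr_id. Qed.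

Lemma l1_nrm_ge0 x : 0 <= l1_nrm x.
Proof. by rewrite l1_nrm.unlock scalar_abs_ge0. Qed.

Lemma l1_nrmD x y : l1_nrm (x + y) <= l1_nrm x + l1_nrm y.
Proof. by rewrite -(ler_scalar (F := F)) rmorphD /= -!normr_l1 ler_normD. Qed.

Lemma l1_nrmZ (a : K) x : l1_nrm (a *: x) = scalar_abs a * l1_nrm x.
Proof. by rewrite l1_nrm.unlock normrZ scalar_absM (scalar_abs_norm a). Qed.

Lemma l1_nrmN x : l1_nrm (- x) = l1_nrm x.
Proof. by rewrite l1_nrm.unlock normrN. Qed.

Lemma l1_nrmB x y : l1_nrm (x - y) = l1_nrm (y - x).
Proof. by rewrite -l1_nrmN opprB. Qed.

Lemma l1_nrm0 : l1_nrm (0 : L) = 0.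
Proof. by rewrite l1_nrm.unlock normr0 scalar_abs0. Qed.

Lemma l1_nrm_eq0 x : l1_nrm x = 0 -> x = 0.
Proof. by move=> x0; apply/normr0_eq0; rewrite normr_l1 x0 rmorph0. Qed.

Lemma series_scalar (x : nat -> K^o) n :
  series (fun n => `|x n| : K^o) n =
  scalar_of_real F (\sum_(0 <= i < n) scalar_abs (x i)).
Proof.
by rewrite /series /= rmorph_sum; apply: eq_bigr => i _; exact: normr_scalar.
Qed.

Lemma l1_psum_le x n : \sum_(0 <= i < n) scalar_abs (x i) <= l1_nrm x.
Proof.
rewrite -(ler_scalar (F := F)) -series_scalar -normr_l1.
exact: (@psum_le_lim R F x n (@l1P _ _ x)).
Qed.

Lemma l1_nrm_le x (M : R) :
  (forall n, \sum_(0 <= i < n) scalar_abs (x i) <= M) -> l1_nrm x <= M.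
Proof.
move=> xM; rewrite -(ler_scalar (F := F)) -normr_l1.
apply: (@cvg_le_norm K (series (fun n => `|x n| : K^o))
  (fun=> scalar_of_real F M)); last 2 first.
- exact: (@l1P _ _ x).
- exact: cvg_cst.
- by move=> n; rewrite series_scalar ler_scalar.
Qed.

Lemma abs_summable_le (x : nat -> K^o) (M : R) :
  (forall n, \sum_(0 <= i < n) scalar_abs (x i) <= M) -> abs_summable x.
Proof.
move=> xM; apply: (@abs_summable_bounded _ _ _ (scalar_of_real F M)) => n.
by rewrite series_scalar ler_scalar.
Qed.

Lemma l1_coord_le x n : scalar_abs (x n) <= l1_nrm x.
Proof.
apply: le_trans (l1_psum_le x n.+1); rewrite big_nat_recr //= lerDr.
by apply: sumr_ge0 => i _; exact: scalar_abs_ge0.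
Qed.

Lemma l1_ext x y : (forall n, x n = y n) -> x = y.
Proof. by move=> xy; apply/val_inj/funext. Qed.

Lemma l1_addE x y n : (x + y : L) n = x n + y n. Proof. by []. Qed.
Lemma l1_oppE x n : (- x : L) n = - x n. Proof. by []. Qed.

Definition l1_of (x : nat -> K^o) (sx : abs_summable x) : L := L1 (mem_set sx).

Lemma l1_sumE (I : Type) (s : seq I) (f : I -> L) k :
  (\sum_(i <- s) f i : L) k = \sum_(i <- s) f i k.
Proof. exact: (big_morph (fun x : L => x k)). Qed.

Lemma l1_nrm_sum (I : Type) (s : seq I) (f : I -> L) :
  l1_nrm (\sum_(i <- s) f i) <= \sum_(i <- s) l1_nrm (f i).
Proof.
elim/big_rec2 : _ => [|i y1 y2 _ h]; first by rewrite l1_nrm0.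
by apply: le_trans (l1_nrmD _ _) _; rewrite lerD2l.
Qed.

Lemma l1_nbhs0P (U : set L) :
  nbhs (0 : L) U <-> exists2 r : R, 0 < r & forall x, l1_nrm x < r -> U x.
Proof.
split => [/nbhs_ballP[e /= e0 eU]|[r r0 rU]].
  have [r r0 eE] := gt0_scalarP e0; exists r => // x xr; apply: eU.
  by rewrite -ball_normE /= sub0r normrN normr_l1 eE ltr_scalar.
apply/nbhs_ballP; exists (scalar_of_real F r) => /=; first by rewrite scalar_gt0.
move=> x; rewrite -ball_normE /= sub0r normrN normr_l1 ltr_scalar; exact: rU.
Qed.

Lemma l1_bounded_continuous (f : L -> L) (C : R) : linear f ->
  (forall x, l1_nrm (f x) <= C * l1_nrm x) -> continuous f.
Proof.
move=> lf fC; apply: linear_continuous_at0 => // U /l1_nbhs0P[r r0 rU].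
apply/l1_nbhs0P; exists (r / (`|C| + 1)).
  by rewrite divr_gt0 // ltr_wpDl.
move=> x xr; apply: rU; apply: le_lt_trans (fC x) _.
apply: (@le_lt_trans _ _ ((`|C| + 1) * l1_nrm x)).
  by rewrite ler_wpM2r ?l1_nrm_ge0 // ler_wpDr // ler_norm.
by rewrite mulrC -ltr_pdivlMr // ltr_wpDl.
Qed.

Lemma l1_coord_continuous_linear n : topological_dual L (fun x => x n).
Proof.
split; first by [].
apply: (@linear_continuous_at0 K L K^o) => // U /nbhs_ballP[e /= e0 eU].
have [r r0 eE] := gt0_scalarP e0; apply/l1_nbhs0P; exists r => // x xr.
apply: eU; rewrite -ball_normE /= sub0r normrN normr_scalar eE ltr_scalar.
by apply: le_lt_trans xr; exact: l1_coord_le.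
Qed.

Lemma l1_coord_cvg T (G : set_system T) (f : T -> L) (l : L) k :
  Filter G -> f @ G --> l -> (f t k : K^o) @[t --> G] --> (l k : K^o).
Proof.
move=> FG fl.
exact: (@cvg_comp _ _ _ f (fun x : L => x k : K^o) G (nbhs l) _ fl
  ((l1_coord_continuous_linear k).2 l)).
Qed.

Fact l1_restrict_subproof (D : pred nat) x :
  abs_summable (fun n => if D n then x n else 0).
Proof.
apply: (@abs_summable_le _ (l1_nrm x)) => n; apply: le_trans (l1_psum_le x n).
apply: ler_sum => i _; case: ifP => // _.
by rewrite scalar_abs0 scalar_abs_ge0.
Qed.

Definition l1_restrict (D : pred nat) x : L := l1_of (@l1_restrict_subproof D x).

Lemma l1_restrictC D x : x = l1_restrict D x + l1_restrict (predC D) x.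
Proof.
by apply: l1_ext => n; rewrite l1_addE /=; case: (D n); rewrite (addr0, add0r).
Qed.

Lemma l1_nrm_approx x (e : R) : 0 < e ->
  exists N, l1_nrm x - e < \sum_(0 <= i < N) scalar_abs (x i).
Proof.
move=> e0; apply: contrapT => /forallNP H.
have : l1_nrm x <= l1_nrm x - e.
  by apply: l1_nrm_le => n; rewrite leNgt; apply/negP; exact: H.
by rewrite lerBrDr gerDl leNgt e0.
Qed.

Lemma psum_le (x : nat -> K^o) m n : (m <= n)%N ->
  \sum_(0 <= i < m) scalar_abs (x i) <= \sum_(0 <= i < n) scalar_abs (x i).
Proof.
move=> mn; rewrite [leRHS](@big_cat_nat _ _ _ m) //= lerDl.
by apply: sumr_ge0 => i _; exact: scalar_abs_ge0.
Qed.

Lemma l1_tail x (e : R) : 0 < e -> exists N, forall n, (N <= n)%N ->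
  l1_nrm (l1_restrict [pred k | n <= k]%N x) <= e.
Proof.
move=> /(l1_nrm_approx x)[N HN]; exists N => n Nn; apply: l1_nrm_le => m.
have [mn|/ltnW nm] := leqP m n.
  rewrite big1_seq //=.
    suff : \sum_(0 <= i < N) scalar_abs (x i) <= l1_nrm x by lra.
    exact: l1_psum_le.
  move=> i; rewrite mem_index_iota => /andP[_ im].
  by rewrite leqNgt (leq_trans im mn) scalar_abs0.
have H1 := l1_psum_le x m; have H2 := psum_le x Nn.
rewrite (@big_cat_nat _ _ _ n) //= in H1.
rewrite (@big_cat_nat _ _ _ n) //= big1_seq ?add0r; last first.
  move=> i /andP[_]; rewrite mem_index_iota => /andP[_ im].
  by rewrite leqNgt im scalar_abs0.
rewrite (_ : \sum_(n <= i < m) _ = \sum_(n <= i < m) scalar_abs (x i)); first lra.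
by apply: eq_big_nat => i /andP[-> _].
Qed.

Lemma l1_nrm_head (x : L) n :
  l1_nrm (l1_restrict [pred k | k < n]%N x) <=
  \sum_(0 <= k < n) scalar_abs (x k).
Proof.
apply: l1_nrm_le => m; have [mn|/ltnW nm] := leqP m n.
  apply: le_trans (psum_le x mn); apply: ler_sum => i _ /=.
  by case: ifP => // _; rewrite scalar_abs0 scalar_abs_ge0.
rewrite (@big_cat_nat _ _ _ n) //= [X in _ + X]big1_seq ?addr0.
  by apply: ler_sum => i _; case: ifP => // _;
    rewrite scalar_abs0 scalar_abs_ge0.
move=> i /andP[_]; rewrite mem_index_iota => /andP[ni _].
by rewrite ltnNge ni scalar_abs0.
Qed.

Lemma l1_nrm_split (x : L) n :
  l1_nrm x <= \sum_(0 <= k < n) scalar_abs (x k) +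
              l1_nrm (l1_restrict [pred k | n <= k]%N x).
Proof.
rewrite {1}(l1_restrictC [pred k | k < n]%N x).
apply: le_trans (l1_nrmD _ _) _; apply: lerD; first exact: l1_nrm_head.
rewrite le_eqVlt; apply/orP; left; apply/eqP; congr l1_nrm.
by apply: l1_ext => k /=; rewrite -leqNgt.
Qed.

End ell1_norm.

(** * Coordinatewise limits and relative compactness in l_1 *)

Section coordinatewise_limits.
Context {R : realType} {F : scalar_kind}.
Local Notation K := (scalars R F).
Local Notation L := (l1 R F).

Lemma l1_cvgP T (G : set_system T) (f : T -> L) (l : L) : Filter G ->
  (f @ G --> l) <->
  forall e : R, 0 < e -> \forall t \near G, l1_nrm (l - f t) < e.
Proof.
move=> FG; split => [/cvgrPdist_lt fl e e0|fl].
  have := fl (scalar_of_real F e); rewrite scalar_gt0 => /(_ e0).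
  by apply: filterS => t; rewrite normr_l1 ltr_scalar.
apply/cvgrPdist_lt => e /gt0_scalarP[r /fl + ->]; apply: filterS => t.
by rewrite normr_l1 ltr_scalar.
Qed.

Lemma psum_cvg_near T (G : set_system T) (x : T -> nat -> K^o) (y : nat -> K^o)
    n (e : R) : Filter G -> (forall n, x t n @[t --> G] --> y n) -> 0 < e ->
  \forall t \near G, \sum_(0 <= i < n) scalar_abs (y i - x t i) < e.
Proof.
move=> FG xy; elim: n e => [|n IH] e e0.
  by apply: nearW => t; rewrite big_geq.
have e2 : 0 < e / 2 by rewrite divr_gt0.
have /scalar_abs_cvgP/(_ _ e2) := xy n.
apply: filterS2 (IH _ e2) => t h1 h2.
by rewrite big_nat_recr //= [e]splitr ltrD.
Qed.

(** Fatou's lemma for counting measure: each finite sum passes to the limit. *)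
Lemma l1_fatou T (G : set_system T) (x : T -> nat -> K^o) (y : nat -> K^o)
    (M : R) : ProperFilter G -> (forall n, x t n @[t --> G] --> y n) ->
  (\forall t \near G, forall n, \sum_(0 <= i < n) scalar_abs (x t i) <= M) ->
  forall n, \sum_(0 <= i < n) scalar_abs (y i) <= M.
Proof.
move=> FG xy xM n; apply/ler_addgt0Pr => e e0.
have [t [h1 h2]] := filter_ex (filterI xM (psum_cvg_near n FG xy e0)).
apply: le_trans (lerD (h1 n) (ltW h2)); rewrite -big_split /=.
apply: ler_sum => i _; apply: le_trans (scalar_absD _ _).
by rewrite addrC subrK.
Qed.

(** Closed balls of l_1 are closed under coordinatewise convergence. *)
Lemma l1_fatou_dist T (G : set_system T) (x : T -> L) (y z : L) (r : R) :
  ProperFilter G -> (forall n, (x t n : K^o) @[t --> G] --> (y n : K^o)) ->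
  (\forall t \near G, l1_nrm (z - x t) <= r) -> l1_nrm (z - y) <= r.
Proof.
move=> FG xy xr; apply: l1_nrm_le.
apply: (@l1_fatou _ G (fun t n => z n - x t n)) => [n|].
  by apply: (@cvgB _ K^o); [exact: cvg_cst|exact: xy].
by apply: filterS xr => t + n; apply: le_trans; exact: (l1_psum_le (z - x t)).
Qed.

(** Plays the role of the extraction of a coordinatewise convergent subsequence
    from a bounded sequence; the limit is in l_1 by Fatou's lemma. *)
Lemma l1_ultra_limit T (G : set_system T) (x : T -> L) (M : R) :
  UltraFilter G -> (\forall t \near G, l1_nrm (x t) <= M) ->
  exists y : L, forall n, (x t n : K^o) @[t --> G] --> (y n : K^o).
Proof.
move=> UG xM; have FG : ProperFilter G by exact: ultra_proper.
have /choice[y xy] n :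
    exists l : K^o, (x t n : K^o) @[t --> G] --> (l : K^o).
  apply: (@ultra_bounded_cvg R F T G _ M) => //.
  by apply: filterS xM => t; apply: le_trans; exact: l1_coord_le.
have sy : abs_summable y.
  apply: (@abs_summable_le R F y M); apply: (@l1_fatou _ G x) => //.
  by apply: filterS xM => t + n; apply: le_trans; exact: l1_psum_le.
by exists (l1_of sy).
Qed.

(** An ultrafilter without limit on the closure of Y still has a coordinatewise
    limit y.  As y is not a limit in norm, the points at distance at least e from y
    form a large set for some e > 0, and so do the points close to y on the first n
    coordinates.  A common point of these sets is then replaced by a point of Y. *)
Lemma not_precompact_humps (Y : set L) (M : R) :
  (forall w, Y w -> l1_nrm w <= M) -> ~ precompact Y ->
  exists y : L, exists2 e : R, 0 < e & forall n (d : R), 0 < d ->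
    exists w : L, [/\ Y w, e <= l1_nrm (w - y) &
      \sum_(0 <= k < n) scalar_abs (w k - y k) <= d].
Proof.
move=> YM; rewrite precompactE compact_ultra => /existsNP[G].
move=> /not_implyP[UG /not_implyP[GY /set0P/negP]].
rewrite negbK => /eqP G0; have FG : ProperFilter G by exact: ultra_proper.
have near_Y w d : closure Y w -> 0 < d -> exists2 v, Y v & l1_nrm (w - v) < d.
  move=> /(_ [set v | l1_nrm (w - v) < d]) wY d0.
  have [|v [Yv wv]] := wY; last by exists v.
  have : (@idfun L) @ nbhs w --> w by exact: cvg_id.
  by move/l1_cvgP; apply.
have GM : \forall w \near G, l1_nrm w <= M + 1.
  apply: filterS GY => w /near_Y /(_ ltr01)[v /YM vM wv].
  rewrite -(subrK v w) addrC; apply: le_trans (l1_nrmD _ _) _.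
  by apply: lerD => //; exact: ltW.
have [y Gy] := l1_ultra_limit (x := id) UG GM.
have [e e0 Ge] : exists2 e, 0 < e & G [set w | e <= l1_nrm (w - y)].
  apply: contrapT => noe.
  suff Gcv : G --> y.
    have : (closure Y `&` [set p | G --> p]) y; last by rewrite G0.
    split => //.
    have -> : closure Y = closure (closure Y).
      by apply/closure_id; exact: closed_closure.
    by move=> U /Gcv GU; exact: filter_ex (filterI GY GU).
  apply/(@l1_cvgP _ G id) => e e0.
  have [//|Gn] := in_ultra_setVsetC [set t | l1_nrm (y - t) < e] UG.
  exfalso; apply: noe; exists e => //; apply: filterS Gn => w /= /negP.
  by rewrite -leNgt l1_nrmB.
exists y, (e / 2); first by rewrite divr_gt0.
move=> n d d0.
have d2 : 0 < d / 2 by rewrite divr_gt0.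
have Gd : G [set w : L | \sum_(0 <= k < n) scalar_abs (y k - w k) < d / 2].
  exact: (@psum_cvg_near _ G (fun w => w)).
have GYe : G (closure Y `&` [set w | e <= l1_nrm (w - y)]) by exact: filterI.
have [w [[Yw we] /= wd]] := filter_ex (filterI GYe Gd).
have m0 : 0 < Num.min (d / 2) (e / 2) by rewrite lt_min !divr_gt0.
have [v Yv] := near_Y w _ Yw m0; rewrite lt_min => /andP[vd ve].
exists v; split; first exact: Yv.
  have wyE : w - y = (v - y) + (w - v) by rewrite [RHS]addrC addrA subrK.
  have := l1_nrmD (v - y) (w - v); rewrite -wyE => h.
  by move: we => /= we; lra.
have h := l1_psum_le (w - v) n.
rewrite [d]splitr; apply: le_trans (lerD (ltW wd) (le_trans h (ltW vd))).
rewrite -big_split /=; apply: ler_sum => k _.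
rewrite -(scalar_absN (y k - w k)) -(scalar_absN ((w - v : L) k)).
apply: le_trans (scalar_absD _ _).
have -> : v k - y k = - (y k - w k) + - (w - v : L) k; last exact: lexx.
by rewrite l1_addE l1_oppE !opprB [RHS]addrC addrA subrK.
Qed.

End coordinatewise_limits.

(** * The gliding hump *)

Section gliding_hump.
Context {R : realType} {F : scalar_kind}.
Local Notation K := (scalars R F).
Local Notation L := (l1 R F).

(** The norm bound holds because consecutive blocks do not overlap. *)
Lemma block_operator (N : nat -> nat) (f : nat -> nat -> K) (C : R) :
  (forall j, N j <= N j.+1)%N -> (forall j k, scalar_abs (f j k) <= C) ->
  exists V : L -> L, [/\ linear V,
    forall x j, V x j = \sum_(N j <= k < N j.+1) f j k * x k &
    forall x, l1_nrm (V x) <= C * l1_nrm x].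
Proof.
move=> ndN fC; have C0 : 0 <= C by apply: le_trans (fC 0 0)%N; exact: scalar_abs_ge0.
pose v (x : L) (j : nat) : K^o := \sum_(N j <= k < N j.+1) f j k * x k.
have vC x n : \sum_(0 <= j < n) scalar_abs (v x j) <= C * l1_nrm x.
  have : \sum_(0 <= j < n) scalar_abs (v x j) <=
      C * \sum_(0 <= k < N n) scalar_abs (x k).
    elim: n => [|n IH].
      rewrite big_geq // mulr_ge0 //; apply: sumr_ge0 => i _.
      exact: scalar_abs_ge0.
    rewrite big_nat_recr //= [in leRHS](@big_cat_nat _ _ _ (N n)) ?leq0n ?ndN //=.
    rewrite mulrDr.
    apply: lerD => //; rewrite mulr_sumr; apply: le_trans (scalar_abs_sum _ _ _) _.
    apply: ler_sum => k _; rewrite scalar_absM.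
    by rewrite ler_wpM2r // scalar_abs_ge0.
  by move=> /le_trans; apply; rewrite ler_wpM2l // l1_psum_le.
have sv x : abs_summable (v x) by apply: abs_summable_le; exact: vC.
exists (fun x => l1_of (sv x)); split => //.
- move=> a x y; apply: l1_ext => j.
  rewrite -[LHS]/(v (a *: x + y) j) -[RHS]/(a * v x j + v y j) /v.
  rewrite mulr_sumr -big_split /=; apply: eq_bigr => k _.
  by rewrite -[LHS]/(f j k * (a * x k + y k)) mulrDr mulrCA.
- by move=> x; apply: l1_nrm_le; exact: vC.
Qed.

(** The points w_j are chosen so that w_j - y is concentrated, up to d = e / 8 at
    each end, on a block of coordinates disjoint from the previous ones.  The j-th
    coordinate of V integrates over the j-th block against the conjugate signs of
    w_j - y, normalised so that w_j - y is sent to 1.  As the blocks start where the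
    tail of y is at most d, V(w_j) - e_j is V applied to a vector of norm at most
    3 d, and the norm of V is at most 1 / (6 d). *)
Lemma gliding_hump (Y : set L) (y : L) (e : R) : 0 < e ->
  (forall n (d : R), 0 < d -> exists w : L, [/\ Y w, e <= l1_nrm (w - y) &
      \sum_(0 <= k < n) scalar_abs (w k - y k) <= d]) ->
  exists2 V : L -> L, continuous_linear L L V &
  exists2 w : nat -> L, (forall j, Y (w j)) &
    forall j, l1_nrm (V (w j) - l1_unit j) <= 2^-1.
Proof.
move=> e0 hump; pose d := e / 8; have d0 : 0 < d by rewrite divr_gt0.
have eE : e = 8 * d by rewrite /d; field.
have [N0 /(_ _ (leqnn _)) yN0] := l1_tail y d0.
pose tail n (x : L) := l1_restrict [pred k | n <= k]%N x.
pose head n (x : L) := l1_restrict [pred k | k < n]%N x.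
have /choice[g gP] (n : nat) : exists p : L * nat, [/\ Y p.1,
    e <= l1_nrm (p.1 - y), \sum_(0 <= k < n) scalar_abs (p.1 k - y k) <= d,
    (n <= p.2)%N & l1_nrm (tail p.2 (p.1 - y)) <= d].
  have [w [Yw we wd]] := hump n d d0.
  have [m mP] := l1_tail (w - y) d0.
  (* Taking maxn keeps the block ends monotone. *)
  exists (w, maxn n m); split => //=; first exact: leq_maxl.
  by apply: mP; exact: leq_maxr.
pose N j := iter j (fun n => (g n).2) N0.
pose w j := (g (N j)).1; pose z j := w j - y.
have ndN j : (N j <= N j.+1)%N by have [] := gP (N j).
have NE : {homo N : i j / (i <= j)%N}.
  by apply: (@homo_leq nat N leq) => [i|j i k|i];
    [exact: leqnn|exact: leq_trans|exact: ndN].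
pose mass j := \sum_(N j <= k < N j.+1) scalar_abs (z j k).
have massP j : 6 * d <= mass j.
  have [_ ze zh _ zt] := gP (N j).
  have := l1_nrm_split (z j) (N j.+1).
  rewrite (@big_cat_nat _ _ _ (N j)) //= -/(mass j).
  move: ze zh zt; rewrite -/(w j) -/(z j) -/(N j.+1) eE /tail.
  lra.
have mass_gt0 j : 0 < mass j by apply: lt_le_trans (massP j); rewrite mulr_gt0.
(* By the convention x / 0 = 0, the coefficient is 0 where z_j vanishes. *)
pose f j k : K := `|z j k| / z j k / scalar_of_real F (mass j).
have [|V [lV VE VC]] := @block_operator N f (6 * d)^-1 ndN.
  move=> j k; rewrite /f !scalar_absM scalar_abs_norm.
  have m0 := mass_gt0 j; have d6 : 0 < 6 * d by rewrite mulr_gt0.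
  rewrite -fmorphV scalar_abs_of_real ger0_norm ?invr_ge0 ?(ltW m0) //.
  have [->|zk0] := eqVneq (z j k) 0.
    by rewrite scalar_abs0 !mul0r invr_ge0 ltW.
  rewrite -scalar_absM mulfV // scalar_abs1 mul1r lef_pV2 ?posrE //.
exists V; first by split => //; exact: l1_bounded_continuous VC.
exists w => [j|j]; first by have [] := gP (N j).
(* V does not see y before N 0, and sends the part of z_j on the j-th block to e_j. *)
pose h := tail N0 y + (head (N j) (z j) + tail (N j.+1) (z j)).
have -> : V (w j) - l1_unit j = V h.
  apply: l1_ext => i; rewrite -[LHS]/(V (w j) i - (i == j)%:R) !VE.
  have yE k : (N i <= k)%N -> w j k = tail N0 y k + z j k.
    move=> ik; have N0k : (N0 <= k)%N by apply: leq_trans ik; exact: (NE 0 i).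
    by rewrite -[z j k]/(w j k - y k) /= N0k addrC subrK.
  rewrite (eq_big_nat _ _ (F2 := fun k => f i k * tail N0 y k + f i k * z j k));
    last first.
    by move=> k /andP[ik _]; rewrite yE // mulrDr.
  rewrite big_split -addrA [in RHS](eq_bigr (fun k =>
    f i k * tail N0 y k + f i k * (head (N j) (z j) + tail (N j.+1) (z j) : L) k));
    last by move=> k _; rewrite mulrDr.
  rewrite [RHS]big_split; congr (_ + _).
  have htE k : (head (N j) (z j) + tail (N j.+1) (z j) : L) k =
      (if (k < N j)%N then z j k else 0) + (if (N j.+1 <= k)%N then z j k else 0).
    by [].
  have [ij|ij|->] := ltngtP i j.
  - rewrite subr0; apply: eq_big_nat => k /andP[_ ki]; rewrite htE.
    have kj : (k < N j)%N by apply: leq_trans ki _; exact: NE.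
    by rewrite kj leqNgt (leq_trans kj (ndN j)) addr0.
  - rewrite subr0; apply: eq_big_nat => k /andP[ik _]; rewrite htE.
    have jk : (N j.+1 <= k)%N by apply: leq_trans ik; exact: NE.
    by rewrite jk ltnNge (leq_trans (ndN j) jk) add0r.
  - rewrite (eq_big_nat _ _ (F2 := fun k =>
      (scalar_of_real F (mass j))^-1 * scalar_of_real F (scalar_abs (z j k)))).
      rewrite -mulr_sumr -rmorph_sum /= mulVf ?subrr; last first.
        by rewrite fmorph_eq0 gt_eqF.
      apply/esym; apply: big1_seq => k /andP[_]; rewrite mem_index_iota.
      move=> /andP[jk kj]; have {}kj : (k < N j.+1)%N by [].
      rewrite -[X in _ * X]/((head (N j) (z j) + tail (N j.+1) (z j) : L) k).
      by rewrite htE ltnNge jk leqNgt kj addr0 mulr0.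
    move=> k _; rewrite /f -normr_scalar.
    have [->|zk0] := eqVneq (z j k) 0; first by rewrite normr0 !(mul0r, mulr0).
    by rewrite mulrAC mulfVK // mulrC.
apply: le_trans (VC h) _.
have hd : l1_nrm h <= 3 * d.
  have [_ ze zh _ zt] := gP (N j).
  apply: le_trans (l1_nrmD _ _) _.
  have := l1_nrmD (head (N j) (z j)) (tail (N j.+1) (z j)).
  have := l1_nrm_head (z j) (N j).
  move: zh zt; rewrite -/(w j) -/(z j) -/(N j.+1) -/(head _ _) -/(tail _ _).
  move: yN0; rewrite -/(tail _ _); lra.
apply: le_trans (_ : (6 * d)^-1 * (3 * d) <= _).
  by rewrite ler_wpM2l // invr_ge0 mulr_ge0 // ltW.
by rewrite le_eqVlt; apply/orP; left; apply/eqP; field; rewrite gt_eqF.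
Qed.

End gliding_hump.

(** * Absolutely convex sets in locally convex spaces *)

Section absolutely_convex_sets.
Context {K : numFieldType}.

(** Induction needs the homogeneous form: a sum whose coefficients have total mass
    C is C times a point of H. *)
Lemma absconvex_sum (E : lmodType K) (H : set E) (I : Type) (s : seq I)
    (c : I -> K) (x : I -> E) : absolutely_convex H -> H 0 ->
  (forall i, H (x i)) -> \sum_(i <- s) `|c i| <= 1 ->
  H (\sum_(i <- s) c i *: x i).
Proof.
move=> cH H0 Hx; set S := \sum_(i <- s) c i *: x i.
set C := \sum_(i <- s) `|c i| => C1.
suff [C0 [v Hv ->]] : 0 <= C /\ exists2 v, H v & S = C *: v.
  rewrite -[_ *: _]addr0 -(scale0r v); apply: cH => //.
  by rewrite normr0 addr0 ger0_norm.
rewrite /S /C; elim: s {S C C1} => [|i s [C0 [v Hv Sv]]].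
  by rewrite !big_nil; split => //; exists 0; rewrite ?scale0r.
rewrite !big_cons Sv; set C := \sum_(_ <- _) _ in C0 Sv *.
have C'0 : 0 <= `|c i| + C by rewrite addr_ge0.
split => //; have [/eqP|C'N0] := eqVneq (`|c i| + C) 0.
  rewrite paddr_eq0 // normr_eq0 => /andP[/eqP -> /eqP ->].
  by exists 0 => //; rewrite !scale0r scaler0 addr0.
exists ((c i / (`|c i| + C)) *: x i + (C / (`|c i| + C)) *: v).
  apply: cH => //; rewrite !normrM normfV (ger0_norm C'0) (ger0_norm C0).
  by rewrite -mulrDl mulfV.
by rewrite scalerDr !scalerA ![_ * (_ / _)]mulrC !divfK.
Qed.

(** Inside a convex neighbourhood C of 0, the vectors whose multiples by scalars of
    the unit disc all lie in C form an absolutely convex set; it is a neighbourhood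
    of 0 because scaling is jointly continuous at (0, 0). *)
Lemma absconvex_nbhs0 (E : tvsType K) (U : set E) : nbhs (0 : E) U ->
  exists H : set E, [/\ nbhs (0 : E) H, absolutely_convex H & H `<=` U].
Proof.
move=> U0; have [B Bc [Bo Bb]] := @locally_convex K E.
have [C [BC C0] CU] := Bb 0 U U0.
have cC (p : K) (x y : E) : 0 <= p -> p <= 1 -> C x -> C y ->
    C (p *: x + (1 - p) *: y).
  move=> p0 p1 Cx Cy.
  have := Bc C (mem_set BC) x y (Itv01 p0 p1) (mem_set Cx) (mem_set Cy).
  by rewrite inE.
have cC0 (p : K) (x : E) : 0 <= p -> p <= 1 -> C x -> C (p *: x).
  by move=> p0 p1 Cx; have := cC p x 0 p0 p1 Cx C0; rewrite scaler0 addr0.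
have cC2 (p q : K) (x y : E) : 0 <= p -> 0 <= q -> p + q <= 1 -> C x -> C y ->
    C (p *: x + q *: y).
  move=> p0 q0 pq Cx Cy; have [qE|qN0] := eqVneq q 0.
    by rewrite qE scale0r addr0; apply: cC0 => //; rewrite qE addr0 in pq.
  have q1p : q <= 1 - p by rewrite lerBrDl.
  have p1 : 0 < 1 - p by apply: lt_le_trans q1p; rewrite lt0r qN0.
  have -> : q *: y = (1 - p) *: ((q / (1 - p)) *: y).
    by rewrite scalerA mulrC divfK // gt_eqF.
  apply: cC => //; first by rewrite -subr_ge0 ltW.
  by apply: cC0 => //; [rewrite divr_ge0 // ltW|rewrite ler_pdivrMr // mul1r].
exists [set v | forall b : K, `|b| <= 1 -> C (b *: v)]; split.
- have nC : nbhs (0 : E) C by apply: open_nbhs_nbhs; split => //; exact: Bo.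
  have := @scale_continuous K E (0, 0) C.
  rewrite /= scale0r => /(_ nC)[[/= B1 B2] [nB1 nB2] B12].
  have /nbhs_ballP[r /= r0 rB1] := nB1.
  have r2 : r / 2 != 0 by rewrite mulf_neq0 ?gt_eqF // invr_gt0.
  apply: filterS (nbhs0Z r2 nB2) => _ [v Bv <-] b b1.
  rewrite scalerA; apply: (B12 (_, _)); split => //=; apply: rB1.
  rewrite -ball_normE /= sub0r normrN normrM (@gtr0_norm _ (r / 2)) ?divr_gt0 //.
  apply: le_lt_trans (_ : r / 2 < r).
    by rewrite ler_piMl // ltW // divr_gt0.
  by rewrite ltr_pdivrMr // mulr_natr mulr2n ltrDl.
- move=> x y a b Hx Hy ab t t1; rewrite scalerDr !scalerA.
  have sgnE (z : K) (v : E) : (forall b : K, `|b| <= 1 -> C (b *: v)) ->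
      exists2 w, C w & (t * z) *: v = `|z| *: w.
    move=> Hv; exists ((t * (z / `|z|)) *: v).
      apply: Hv; rewrite !normrM normfV normr_id.
      have [->|z0] := eqVneq z 0; first by rewrite normr0 mul0r mulr0.
      by rewrite mulfV ?normr_eq0 // mulr1.
    rewrite scalerA; congr (_ *: _).
    have [->|z0] := eqVneq z 0; first by rewrite normr0 mul0r !mulr0.
    by rewrite mulrCA (mulrC `|z|) divfK // normr_eq0.
  have [u Cu ->] := sgnE a x Hx; have [v Cv ->] := sgnE b y Hy.
  exact: cC2.
- by move=> v /(_ 1); rewrite normr1 scale1r => /(_ (lexx _)) /CU.
Qed.

Lemma tvs_cvgD (E : tvsType K) T (G : set_system T) (f g : T -> E) (a b : E) :
  Filter G -> f @ G --> a -> g @ G --> b -> f t + g t @[t --> G] --> a + b.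
Proof.
move=> FG fa gb.
apply: (@cvg_comp _ _ _ (fun t => (f t, g t)) (fun z : E * E => z.1 + z.2) G
  (nbhs (a, b))); last exact: (@add_continuous E (a, b)).
exact: cvg_pair fa gb.
Qed.

Lemma tvs_cvgZ (E : tvsType K) T (G : set_system T) (f : T -> E) (k : K) (a : E) :
  Filter G -> f @ G --> a -> k *: f t @[t --> G] --> k *: a.
Proof.
move=> FG fa.
have kc : (fun=> k : K^o) @ G --> (k : K^o) by exact: cvg_cst.
apply: (@cvg_comp _ _ _ (fun t => (k, f t)) (fun z : K^o * E => z.1 *: z.2) G
  (nbhs ((k : K^o), a))); last exact: (@scale_continuous K E (k, a)).
exact: cvg_pair kc fa.
Qed.

End absolutely_convex_sets.

(** * Summing a bounded sequence with l_1 coefficients *)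

Section synthesis.
Context {R : realType} {F : scalar_kind}.
Local Notation K := (scalars R F).
Local Notation L := (l1 R F).

Lemma bounded_absorbed (E : tvsType K) (A U : set E) :
  tvs_bounded A -> nbhs (0 : E) U -> exists2 d : R, 0 < d &
    forall (a : E) (b : K), A a -> scalar_abs b <= d -> U (b *: a).
Proof.
move=> bA /absconvex_nbhs0[H [H0 cH HU]]; have [s s0 sA] := bA H H0.
have t0 : 0 < s * 2 by rewrite mulr_gt0.
have [t t0' tE] := gt0_scalarP t0.
exists t^-1; first by rewrite invr_gt0.
move=> a b Aa bd; apply: HU.
have [|u Hu <-] := sA (s * 2) _ a Aa; first by rewrite ltr_pMr // ltr1n.
rewrite scalerA -[_ *: _]addr0 -(scale0r 0); apply: cH => //.
  exact: nbhs_singleton.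
rewrite normr0 addr0 normr_scalar scalar_absM -[leRHS](rmorph1 (scalar_of_real F)).
rewrite ler_scalar tE scalar_abs_of_real gtr0_norm //.
by rewrite -(ler_pdivlMr _ _ t0') div1r.
Qed.

(** In a locally convex space, combinations of bounded vectors are small as soon as
    their coefficients are small in l_1. *)
Lemma l1_bounded_combination (E : tvsType K) (a : nat -> E) (U : set E) :
  tvs_bounded (range a) -> nbhs (0 : E) U -> exists2 d : R, 0 < d &
    forall (s : seq nat) (c : nat -> K), \sum_(i <- s) scalar_abs (c i) <= d ->
      U (\sum_(i <- s) c i *: a i).
Proof.
move=> ba /absconvex_nbhs0[H [H0 cH HU]].
have [d d0 dH] := bounded_absorbed ba H0.
exists d => // s c cd; apply: HU.
have dN0 : scalar_of_real F d != 0 by rewrite fmorph_eq0 gt_eqF.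
rewrite (eq_bigr (fun i => (c i / scalar_of_real F d) *:
    (scalar_of_real F d *: a i))); last by move=> i _; rewrite scalerA divfK.
apply: absconvex_sum => //; first exact: nbhs_singleton.
  move=> i; apply: dH; first by exists i.
  by rewrite scalar_abs_of_real ger0_norm // ltW.
rewrite (eq_bigr (fun i => scalar_of_real F (scalar_abs (c i) / d))).
  rewrite -rmorph_sum /= -(rmorph1 (scalar_of_real F)) ler_scalar -mulr_suml.
  by rewrite ler_pdivrMr // mul1r.
move=> i _; rewrite normrM normfV !normr_scalar scalar_abs_of_real.
by rewrite rmorphM /= fmorphV ger0_norm // ltW.
Qed.

(** With t_n the square root of the tail r_n = |c_n| + |c_(n+1)| + ..., one has
    |c_n| = t_n^2 - t_(n+1)^2 <= 2 t_n (t_n - t_(n+1)).  So b_n = 2 t_0 t_n leaves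
    quotients d_n bounded by the terms of a telescoping sum. *)
Lemma l1_factor (c : L) : exists (b : nat -> R) (d : nat -> K),
  [/\ forall n, c n = scalar_of_real F (b n) * d n,
      b @ \oo --> (0 : R) &
      forall n, \sum_(0 <= i < n) scalar_abs (d i) <= 1].
Proof.
pose r n := l1_nrm c - \sum_(0 <= i < n) scalar_abs (c i).
have r0 n : 0 <= r n by rewrite subr_ge0 l1_psum_le.
have rS n : scalar_abs (c n) = r n - r n.+1.
  by rewrite /r big_nat_recr //=; lra.
pose t n := Num.sqrt (r n); have t0 n : 0 <= t n by exact: sqrtr_ge0.
have tr n : t n ^+ 2 = r n by rewrite sqr_sqrtr.
have tS n : t n.+1 <= t n.
  by rewrite ler_sqrt // -subr_ge0 -rS scalar_abs_ge0.
have tle n : t n <= t 0%N.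
  by elim: n => // n; apply: le_trans.
pose b n := 2 * t 0%N * t n; pose d n : K := c n / scalar_of_real F (b n).
have b0 n : 0 <= b n by rewrite !mulr_ge0.
have dle n : scalar_abs (d n) <= (t n - t n.+1) / t 0%N.
  rewrite /d scalar_absM -fmorphV scalar_abs_of_real ger0_norm ?invr_ge0 //.
  have [tn0|tn0] := eqVneq (t n) 0.
    by rewrite /b tn0 mulr0 invr0 mulr0 divr_ge0 // subr_ge0 -tn0.
  have tnp : 0 < t n by rewrite lt0r tn0 t0.
  have t0p : 0 < t 0%N by apply: lt_le_trans (tle n).
  rewrite ler_pdivrMr ?mulr_gt0 // rS -!tr /b.
  have -> : (t n - t n.+1) / t 0%N * (2 * t 0%N * t n) =
      (t n - t n.+1) * (2 * t n) by field; rewrite gt_eqF.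
  rewrite subr_sqr; apply: ler_wpM2l; first by rewrite subr_ge0.
  by have := tS n; lra.
exists b, d; split.
- move=> n; rewrite /d; have [bn0|bn0] := eqVneq (b n) 0; last first.
    by rewrite mulrC divfK // fmorph_eq0.
  have tn0 : t n = 0.
    have /eqP := bn0; rewrite !mulf_eq0 pnatr_eq0 /= => /orP[/eqP t00|/eqP //].
    by apply/le_anti; rewrite t0 andbT -t00 tle.
  have : scalar_abs (c n) = 0.
    have := scalar_abs_ge0 (c n); rewrite rS -!tr tn0 expr0n /= => h.
    by apply/le_anti; rewrite h andbT sub0r oppr_le0 sqr_ge0.
  move/eqP; rewrite scalar_abs_eq0 => /eqP ->.
  by rewrite mul0r mulr0.
- have rcvg : r @ \oo --> (0 : R).
    apply/cvgrPdist_lt => e e0; have [N HN] := l1_nrm_approx c e0.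
    exists N => // n /= Nn; rewrite sub0r normrN ger0_norm //.
    by have := psum_le c Nn; rewrite /r; lra.
  have tcvg : t @ \oo --> (0 : R).
    rewrite -(sqrtr0 R); apply: continuous_cvg => //.
    exact: sqrt_continuous.
  rewrite -(mulr0 (2 * t 0%N)); exact: cvgMr.
move=> n; have : \sum_(0 <= i < n) scalar_abs (d i) <= (t 0%N - t n) / t 0%N.
  elim: n => [|n IH]; first by rewrite big_geq // subrr mul0r.
  rewrite big_nat_recr //=; apply: le_trans (lerD IH (dle n)) _.
  by rewrite -mulrDl addrA subrK.
move=> /le_trans; apply; have [->|t00] := eqVneq (t 0%N) 0.
  by rewrite invr0 mulr0.
have t0p : 0 < t 0%N by rewrite lt0r t00 t0.
by rewrite (ler_pdivrMr _ _ t0p) mul1r gerBl.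
Qed.

Definition psum_series (E : lmodType K) (a : nat -> E) (c : nat -> K) n : E :=
  \sum_(0 <= i < n) c i *: a i.

(** The partial sums form a Cauchy sequence
    which stays in the closed absolutely convex hull of the null sequence (b_n a_n)
    of [l1_factor]; this hull is compact, and a Cauchy sequence converges to each of
    its cluster points. *)
Lemma l1_series_cvg (E : tvsType K) (a : nat -> E) (c : L) :
  locally_complete E -> tvs_bounded (range a) ->
  exists l : E, psum_series a c @ \oo --> l.
Proof.
move=> lcE ba; have [b [d [cE b0 d1]]] := l1_factor c.
pose v n := scalar_of_real F (b n) *: a n.
have v0 : v @ \oo --> (0 : E).
  move=> U U0; have [e e0 eU] := bounded_absorbed ba U0.
  move/cvgrPdist_lt : b0 => /(_ e e0); apply: filterS => n /=.
  rewrite sub0r normrN => be; apply: eU; first by exists n.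
  by rewrite scalar_abs_of_real ltW.
pose H := smallest (@absolutely_convex K E) (range v).
have cH : absolutely_convex H.
  move=> x y s t Hx Hy st M [cM vM].
  by apply: (cM) => //; [exact: (Hx M (conj cM vM))|exact: (Hy M (conj cM vM))].
have Hv n : H (v n) by move=> M [_]; apply; exists n.
have H0 : H 0.
  have := cH (v 0%N) (v 0%N) 0 0 (Hv 0%N) (Hv 0%N).
  by rewrite !scale0r addr0 normr0 addr0; apply.
have HS n : H (psum_series a c n).
  rewrite /psum_series (eq_bigr (fun i => d i *: v i)); last first.
    by move=> i _; rewrite /v scalerA cE mulrC.
  apply: absconvex_sum => //.
  rewrite (eq_bigr (fun i => scalar_of_real F (scalar_abs (d i)))).
    by rewrite -rmorph_sum /= -(rmorph1 (scalar_of_real F)) ler_scalar.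
  by move=> i _; rewrite normr_scalar.
have GH : (psum_series a c @ \oo) (closed_absconvex_hull (range v)).
  by exists 0%N => // n _; apply: subset_closure; exact: HS.
have [l [_ cl]] := lcE v v0 _ _ GH.
exists l => U /(nbhsB (- l)); rewrite addNr => U0.
(* The factor 2 makes room for the sum of two elements of W. *)
have U2 : nbhs (0 : E) [set x | (+%R (- l) @` U) (2 *: x)].
  have := @tvs_cvgZ K E _ (nbhs (0 : E)) id 2 0 _ cvg_id.
  by rewrite scaler0 => /(_ _ _ U0).
have [W [W0 cW WU]] := absconvex_nbhs0 U2.
have [e e0 eW] := l1_bounded_combination ba W0.
have [N HN] := l1_nrm_approx c e0.
have [_ [[m /= Nm <-] [w Ww wE]]] :
    ([set psum_series a c n | n in [set n | (N <= n)%N]] `&` (+%R l @` W)) !=set0.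
  by apply: cl; [exists N => // n Nn; exists n|exact: nbhsT].
(* The m-th sum is close to l, and the n-th sum is close to the m-th one. *)
exists m => // n /= mn.
have Wmn : W (\sum_(m <= i < n) c i *: a i).
  apply: eW; have := psum_le c Nm; have := l1_psum_le c n.
  by rewrite (@big_cat_nat _ _ _ m) //=; lra.
have := WU (2^-1 *: w + 2^-1 *: \sum_(m <= i < n) c i *: a i) _.
rewrite -scalerDr /= scalerA mulfV ?pnatr_eq0 // scale1r => /(_ _)[|u Uu uE].
  rewrite scalerDr; apply: cW => //.
  by rewrite ger0_norm ?invr_ge0 // [leRHS](@splitr K) div1r.
suff -> : psum_series a c n = u by [].
apply: (addrI (- l)); rewrite uE /psum_series (@big_cat_nat _ _ _ m) //=.
by rewrite -/(psum_series a c m) -wE addrA addKr.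
Qed.

End synthesis.

(** * Synthesis operators and perturbations of the identity *)

Section operators.
Context {R : realType} {F : scalar_kind}.
Local Notation K := (scalars R F).
Local Notation L := (l1 R F).

(** Continuity at 0: the partial sums of S(c) stay in a small closed neighbourhood
    when c has small norm. *)
Lemma synthesis_operator (E : tvsType K) (a : nat -> E) :
  hausdorff_space E -> locally_complete E -> tvs_bounded (range a) ->
  exists2 S : L -> E, continuous_linear L E S &
    forall c : L, psum_series a c @ \oo --> S c.
Proof.
move=> hE lcE ba.
have /choice[S Scvg] (c : L) : exists l : E, psum_series a c @ \oo --> l.
  exact: l1_series_cvg.
have lS : linear S.
  move=> k x y; apply: (@cvg_unique _ hE (psum_series a (k *: x + y : L) @ \oo)).
    exact: Scvg.
  rewrite (_ : psum_series a _ =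
      fun n => k *: psum_series a x n + psum_series a y n).
    by apply: tvs_cvgD; [exact: tvs_cvgZ|exact: Scvg].
  apply/funext => n; rewrite /psum_series scaler_sumr -big_split /=.
  by apply: eq_bigr => i _; rewrite scalerA -scalerDl.
exists S => //; split => //.
apply: linear_continuous_at0 => // U U0.
have [V V0 VU] := @uniform_regular E 0 U U0.
have [d d0 dV] := l1_bounded_combination ba V0.
apply/l1_nbhs0P; exists d => // c cd; apply: VU => W /Scvg[n _ Wn].
exists (psum_series a c n); split; last exact: Wn n (leqnn n).
by apply: dV; apply: le_trans (l1_psum_le c n) (ltW cd).
Qed.

Lemma psum_series_unit (E : lmodType K) (a : nat -> E) m n : (m < n)%N ->
  psum_series a (l1_unit m : L) n = a m.
Proof.
move=> mn; rewrite /psum_series big_mkord (bigD1 (Ordinal mn)) //= eqxx scale1r.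
by rewrite big1 ?addr0 // => i; rewrite -val_eqE /= => /negPf ->; rewrite scale0r.
Qed.

Lemma synthesis_unit (E : tvsType K) (a : nat -> E) (S : L -> E) n :
  hausdorff_space E -> (forall c : L, psum_series a c @ \oo --> S c) ->
  S (l1_unit n) = a n.
Proof.
move=> hE Scvg; apply: (@cvg_unique _ hE (psum_series a (l1_unit n : L) @ \oo)).
  exact: Scvg.
move=> U /nbhs_singleton Ua; exists n.+1 => // m /= nm.
by rewrite psum_series_unit.
Qed.

(** Completeness of l_1, with a rate: an ultrafilter limit along the sequence is the
    only candidate, and Fatou's lemma transfers the bounds to it. *)
Lemma l1_complete (u : nat -> L) (q : nat -> R) :
  (forall k j, l1_nrm (u k - u (k + j)%N) <= q k) ->
  exists y, forall k, l1_nrm (u k - y) <= q k.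
Proof.
move=> uq; have [G [UG sG]] := ultraFilterLemma (eventually_filter).
have FG : ProperFilter G by exact: ultra_proper.
have near_tail k (P : nat -> Prop) : (forall j, P (k + j)%N) ->
    \forall n \near G, P n.
  move=> kP; apply: sG; exists k => // n /= kn.
  by rewrite -(subnKC kn).
have [|y uy] := @l1_ultra_limit R F nat G u (l1_nrm (u 0%N) + q 0%N) UG.
  apply: (near_tail 0%N) => j; have := l1_nrmD (u 0%N) (- (u 0%N - u j)).
  by rewrite opprB addrC subrK l1_nrmB; have := uq 0%N j; rewrite add0n; lra.
exists y => k; apply: l1_fatou_dist uy _.
by apply: (near_tail k) => j; exact: uq.
Qed.

Lemma le0_geometric (a C : R) : (forall k, a * 2 ^+ k <= C) -> a <= 0.
Proof.
move=> aC; rewrite leNgt; apply/negP => a0.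
have C0 : 0 <= C by apply: le_trans (aC 0%N); rewrite mulr1 ltW.
have := archi_boundP (divr_ge0 C0 (ltW a0)).
set k := Num.bound _ => Ck; have := aC k; rewrite leNgt => /negP; apply.
move: Ck; rewrite ltr_pdivrMr // mulrC => /lt_le_trans; apply.
by rewrite ler_pM2l // -natrX ler_nat ltnW // ltn_expl.
Qed.

(** The Neumann series.  It is summed through the residuals r_k = (1 - B)^k x, which
    halve at each step: the partial sums u_k satisfy B(u_k) = x - r_k, and B is
    bounded below, so they form a Cauchy sequence. *)
Lemma half_perturbation (B : L -> L) : linear B ->
  (forall x, l1_nrm (B x - x) <= 2^-1 * l1_nrm x) ->
  exists2 W : L -> L, continuous_linear L L W & forall x, W (B x) = x.
Proof.
move=> lB Bx; have [b Bb] := linear_pack lB.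
have Bxl x : l1_nrm x <= 2 * l1_nrm (B x).
  have := l1_nrmD (B x) (x - B x); rewrite addrC subrK l1_nrmB.
  by have := Bx x; lra.
have Bsub x y : B (x - y) = B x - B y by rewrite Bb linearB.
have Binj x y : B x = B y -> x = y.
  move=> xy; apply/eqP; rewrite -subr_eq0; apply/eqP/l1_nrm_eq0/le_anti.
  rewrite l1_nrm_ge0 andbT; have := Bxl (x - y).
  by rewrite Bsub xy subrr l1_nrm0 mulr0.
have /choice[W BW] x : exists y, B y = x.
  pose r k := iter k (fun v => v - B v) x.
  pose u k := \sum_(i < k) r i.
  have rS k : r k.+1 = r k - B (r k) by [].
  have uB k : B (u k) = x - r k.
    rewrite /u Bb; elim: k => [|k IH].
      by rewrite big_ord0 linear0 /r /= subrr.
    by rewrite big_ord_recr linearD IH rS -Bb opprB addrA addrAC.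
  have r2 k : l1_nrm (r k) * 2 ^+ k <= l1_nrm x.
    elim: k => [|k]; first by rewrite mulr1.
    apply: le_trans; rewrite rS exprS mulrA ler_wpM2r ?exprn_ge0 //.
    by rewrite l1_nrmB; have := Bx (r k); lra.
  have r2D k j : l1_nrm (r (k + j)%N) * 2 ^+ k <= l1_nrm x.
    apply: le_trans (r2 (k + j)%N); rewrite ler_wpM2l ?l1_nrm_ge0 //.
    by rewrite exprD ler_peMr ?exprn_ge0 // exprn_ege1 // ler1n.
  have [|y uy] := @l1_complete u (fun k => 4 * l1_nrm x / 2 ^+ k).
    move=> k j; rewrite ler_pdivlMr ?exprn_gt0 //.
    apply: (@le_trans _ _ (2 * (l1_nrm (r (k + j)%N) + l1_nrm (r k)) * 2 ^+ k)).
      rewrite ler_wpM2r ?exprn_ge0 //; apply: le_trans (Bxl _) _.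
      rewrite Bsub !uB opprB addrC addrA subrK ler_pM2l //.
      by apply: le_trans (l1_nrmD _ _) _; rewrite l1_nrmN.
    by have := r2D k j; have := r2 k; nra.
  exists y; apply/esym/eqP; rewrite -subr_eq0; apply/eqP/l1_nrm_eq0/le_anti.
  rewrite l1_nrm_ge0 andbT; apply: (@le0_geometric _ (7 * l1_nrm x)) => k.
  have xBy : l1_nrm (x - B y) <= 3 / 2 * l1_nrm (u k - y) + l1_nrm (r k).
    have -> : x - B y = B (u k - y) + r k by rewrite Bsub uB addrAC subrK.
    apply: le_trans (l1_nrmD _ _) _; rewrite lerD2r.
    have := l1_nrmD (B (u k - y) - (u k - y)) (u k - y); rewrite subrK.
    by have := Bx (u k - y); lra.
  have p0 : 0 <= 2 ^+ k :> R by rewrite exprn_ge0.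
  apply: le_trans (ler_wpM2r p0 xBy) _; rewrite mulrDl -mulrA.
  by have := uy k; rewrite ler_pdivlMr ?exprn_gt0 //; have := r2 k; lra.
have lW : linear W.
  by move=> k x y; apply: Binj; rewrite BW lB !BW.
exists W => [|x]; last by apply: Binj; rewrite BW.
split => //; apply: (@l1_bounded_continuous _ _ _ 2) => // x.
by have := Bxl (W x); rewrite BW.
Qed.

End operators.

(** * Complemented copies of l_1 *)

Section dichotomy.
Context {R : realType} {F : scalar_kind}.
Local Notation K := (scalars R F).
Local Notation L := (l1 R F).

Lemma psum_unit_coord (c : nat -> K) k n : (k < n)%N ->
  (psum_series (l1_unit : nat -> L) c n) k = c k.
Proof.
move=> kn; rewrite /psum_series l1_sumE.
rewrite (eq_bigr (fun i => c i * (k == i)%:R)) // big_mkord.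
rewrite (bigD1 (Ordinal kn)) //= eqxx mulr1 big1 ?addr0 // => i.
by rewrite -val_eqE /= eq_sym => /negPf ->; rewrite mulr0.
Qed.

(** V S - 1 is bounded by 1/2 on finitely supported sequences by the hypothesis on
    V(a_n), and on all of l_1 by Fatou's lemma. *)
Lemma almost_units_lift (E : tvsType K) (a : nat -> E) (V : E -> L) :
  hausdorff_space E -> locally_complete E -> tvs_bounded (range a) ->
  continuous_linear E L V ->
  (forall n, l1_nrm (V (a n) - l1_unit n) <= 2^-1) ->
  exists S : L -> E, exists W : E -> L,
    [/\ continuous_linear L E S, continuous_linear E L W,
        forall c : L, psum_series a c @ \oo --> S c & forall c, W (S c) = c].
Proof.
move=> hE lcE ba [lV cV] Va.
have [S [lS cS] Scvg] := synthesis_operator hE lcE ba.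
have [W' cW' W'B] : exists2 W : L -> L, continuous_linear L L W &
    forall x, W ((V \o S) x) = x.
  apply: half_perturbation; first exact: linear_fun_comp.
  move=> c /=; rewrite -l1_nrmN -sub0r.
  pose x n : L := \sum_(0 <= i < n) c i *: (V (a i) - l1_unit i).
  apply: (@l1_fatou_dist _ _ _ \oo x) => [k|].
    have h : (V (psum_series a c n) k : K^o) @[n --> \oo] --> (V (S c) k : K^o).
      apply: l1_coord_cvg; exact: (cvg_comp _ _ (Scvg c) (cV (S c))).
    have : (V (psum_series a c n) k - c k : K^o) @[n --> \oo] -->
        (V (S c) k - c k : K^o) by apply: (@cvgB _ K^o) => //; exact: cvg_cst.
    apply: cvg_trans; apply: near_eq_cvg; exists k.+1 => // n /= kn.
    have [v vE] := linear_pack lV.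
    have -> : x n = V (psum_series a c n) - psum_series l1_unit c n.
      rewrite /psum_series vE linear_sum -sumrB; apply: eq_bigr => i _.
      by rewrite scalerBr vE; congr (_ - _); rewrite linearZ.
    by rewrite l1_addE l1_oppE psum_unit_coord.
  apply: nearW => n; rewrite sub0r l1_nrmN.
  apply: le_trans (l1_nrm_sum _ _) _.
  apply: (@le_trans _ _ (2^-1 * \sum_(0 <= i < n) scalar_abs (c i))).
    rewrite mulr_sumr; apply: ler_sum => i _; rewrite l1_nrmZ mulrC.
    by rewrite ler_wpM2r // scalar_abs_ge0.
  by rewrite ler_pM2l ?invr_gt0 // l1_psum_le.
exists S, (W' \o V); split => //; first exact: continuous_linear_comp.
Qed.

Lemma closed_fixed_points (E : topologicalType) (f : E -> E) :
  hausdorff_space E -> continuous f -> closed [set x | f x = x].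
Proof.
move=> hE cf x clx; apply: hE => A B /cf fA xB.
have AB : nbhs x (f @^-1` A `&` B) by exact: filterI.
have [y [/= fy [Ay By]]] := clx _ AB.
by exists y; split => //; move: Ay; rewrite /= fy.
Qed.

(** S o W is the projection.  Its range is the closed span of the a_n because it is
    closed, as the set of fixed points of S o W, while S(c) is the limit of finite
    combinations of the a_n. *)
Lemma l1_section_complemented (E : tvsType K) (a : nat -> E) (S : L -> E)
    (W : E -> L) :
  hausdorff_space E -> continuous_linear L E S -> continuous_linear E L W ->
  (forall c : L, psum_series a c @ \oo --> S c) -> (forall c, W (S c) = c) ->
  l1_sequence a /\ complemented (closed_span (range a)).
Proof.
move=> hE [lS cS] [lW cW] Scvg WS.
have Se n : S (l1_unit n) = a n by apply: synthesis_unit.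
have clS : closed [set x | (S \o W) x = x].
  by apply: closed_fixed_points => // x; apply: continuous_comp; [exact: cW|exact: cS].
have spanE : closed_span (range a) = range S.
  apply/seteqP; split => [x|_ [c _ <-]].
    have /closureS : smallest (@is_subspace K E) (range a) `<=`
        [set x | (S \o W) x = x].
      move=> v; apply; split; last by move=> _ [n _ <-]; rewrite /= -Se WS.
      have [s sE] := linear_pack lS; have [w wE] := linear_pack lW.
      split => [|k u v' /= uE vE]; first by rewrite /= wE linear0 sE linear0.
      by rewrite lW lS uE vE.
    by move=> /[apply]; rewrite -((closure_id _).1 clS) => /= <-; exists (W x).
  move=> U /Scvg[n _ Un]; exists (psum_series a c n); split; last first.
    exact: Un n (leqnn n).
  move=> M [[M0 Mlin] aM]; rewrite /psum_series; elim/big_ind : _ => // [x y Mx My|i _].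
    by rewrite -(scale1r x); exact: Mlin.
  by rewrite -[_ *: _]addr0; apply: Mlin => //; apply: aM; exists i.
have SWx x : range S x -> S (W x) = x by move=> [c _ <-]; rewrite WS.
split; last first.
  exists (S \o W); split.
  - exact: (@continuous_linear_comp _ _ _ _ W S).
  - by apply/funext => x /=; rewrite WS.
  - rewrite spanE; apply/seteqP; split => [_ [x _ <-]|_ [c _ <-]].
      by exists (W x).
    by exists (S c) => //=; rewrite WS.
exists W; last by move=> n; rewrite -Se WS.
rewrite spanE; split; [by move=> k x y _ _; exact: lW|exact: continuous_subspaceT|].
by exists S; split => //; exact: continuous_subspaceT.
Qed.

Lemma not_coarse_1_limited (E : tvsType K) (A : set E) :
  hausdorff_space E -> locally_complete E -> tvs_bounded A ->
  ~ coarse_1_limited A ->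
  exists a : nat -> E, (forall n, A (a n)) /\
    exists S : L -> E, exists W : E -> L,
    [/\ continuous_linear L E S, continuous_linear E L W,
        forall c : L, psum_series a c @ \oo --> S c & forall c, W (S c) = c].
Proof.
move=> hE lcE bA /existsNP[T /not_implyP[cT TA]].
have [d d0 dT] : exists2 d : R, 0 < d & forall a (b : K), A a ->
    scalar_abs b <= d -> l1_nrm (T (b *: a)) < 1.
  apply: (bounded_absorbed (U := [set v | l1_nrm (T v) < 1]) bA).
  have [t tE] := linear_pack cT.1.
  have /l1_cvgP/(_ _ ltr01) := cT.2 0.
  by apply: filterS => v; rewrite /= tE linear0 sub0r l1_nrmN.
have TM w : (T @` A) w -> l1_nrm w <= d^-1.
  move=> [a Aa <-]; have := dT a (scalar_of_real F d) Aa.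
  have [t tE] := linear_pack cT.1.
  rewrite scalar_abs_of_real ger0_norm ?(ltW d0) // tE linearZ l1_nrmZ.
  rewrite scalar_abs_of_real ger0_norm ?(ltW d0) // => /(_ (lexx _)) h.
  by rewrite -[d^-1]div1r ler_pdivlMr // mulrC ltW.
have [y [e e0 hump]] := not_precompact_humps TM TA.
have [V cV [w Tw Vw]] := gliding_hump e0 hump.
have /choice[a aP] n : exists v, A v /\ T v = w n.
  by have [v Av vw] := Tw n; exists v.
exists a; split; first by move=> n; have [] := aP n.
apply: (@almost_units_lift _ _ (V \o T)) => //.
- move=> U /bA[s s0 sA]; exists s => // t st _ [n _ <-]; apply: sA => //.
  by have [] := aP n.
- exact: continuous_linear_comp.
by move=> n /=; have [_ ->] := aP n.
Qed.

(** At each point x, the coordinates far out are small on a whole neighbourhood of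
    x; compactness makes the rank uniform. *)
Lemma precompact_coord (Y : set L) (e : R) : 0 < e -> precompact Y ->
  \forall n \near \oo, forall y, Y y -> scalar_abs (y n) < e.
Proof.
move=> e0; rewrite precompactE => /compact_near_coveringP.
move=> /(_ nat \oo (fun n (y : L) => scalar_abs (y n) < e) _) [].
  move=> x _; have e2 : 0 < e / 2 by rewrite divr_gt0.
  have [N HN] := l1_tail x e2.
  exists ([set y | l1_nrm (x - y) < e / 2], [set n | (N <= n)%N]).
    split => /=; last by exists N.
    have : (@idfun L) @ nbhs x --> x by exact: cvg_id.
    by move/l1_cvgP; apply.
  move=> [y n] /= [xy Nn].
  have -> : y n = - (x - y : L) n + x n.
    by rewrite l1_addE l1_oppE opprB subrK.
  apply: le_lt_trans (scalar_absD _ _) _; rewrite scalar_absN [e]splitr.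
  apply: ltr_leD; first by apply: le_lt_trans xy; exact: l1_coord_le.
  have := HN N (leqnn N); apply: le_trans.
  apply: le_trans (l1_coord_le _ n).
  by rewrite /= Nn.
move=> N _ HN; exists N => // n Nn y Yy; apply: HN => //.
exact: subset_closure.
Qed.

End dichotomy.

(** * Coarse 1-limited and (1,oo)-limited sets *)

Section coarse_limited_sets.
Context {R : realType} {F : scalar_kind}.
Local Notation K := (scalars R F).
Local Notation L := (l1 R F).

Lemma coarse_1_limited_no_l1 (E : tvsType K) (A : set E) (x : nat -> E) :
  coarse_1_limited A -> (forall n, A (x n)) -> l1_sequence x ->
  complemented (closed_span (range x)) -> False.
Proof.
move=> cA Ax [T [Tlin Tcts _] Tx] [P [[lP cP] PP rP]].
have PL v : closed_span (range x) (P v) by rewrite -rP; exists v.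
have Px n : P (x n) = x n.
  have : closed_span (range x) (x n).
    by apply: subset_closure; apply: sub_gen_smallest; exists n.
  by rewrite -rP => -[v _ <-]; rewrite -[LHS]/((P \o P) v) PP.
have cTP : continuous_linear E L (T \o P).
  split => [k u v|v U TU] /=; first by rewrite lP Tlin.
  have TPv : nbhs (P v) [set w | closed_span (range x) w -> U (T w)].
    by have /subspace_continuousP/(_ _ (PL v) _ TU) := Tcts.
  have := cP v _ TPv; rewrite -[nbhs _ _]/(nbhs v (P @^-1` _)) => nP.
  rewrite -[nbhs _ _]/(nbhs v ((T \o P) @^-1` U)).
  by apply: filterS nP => w /=; apply.
have [N _ /(_ N (leqnn N)) small] := precompact_coord ltr01 (cA _ cTP).
have : scalar_abs ((l1_unit N : L) N) < 1.
  by apply: small; exists (x N) => //=; rewrite Px Tx.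
by rewrite /= eqxx scalar_abs1 ltxx.
Qed.

(** The coordinate functionals of W are summable at every point but equal 1 at the
    points a_n. *)
Lemma one_infty_limited_coarse (E : tvsType K) (A : set E) :
  hausdorff_space E -> locally_complete E -> tvs_bounded A ->
  one_infty_limited A -> coarse_1_limited A.
Proof.
move=> hE lcE bA limA; apply: contrapT.
move=> /(not_coarse_1_limited hE lcE bA)[a [Aa [S [W [_ cW Scvg WS]]]]].
have := limA (fun n v => W v n) _ (fun v => @l1P _ _ (W v)).
move=> /(_ (fun n => continuous_linear_comp cW (l1_coord_continuous_linear n))).
move=> sup0; suff h : \forall n \near \oo, (1%:E <=
    ereal_sup [set (scalar_abs (W v n))%:E | v in A])%E.
  have h10 : (1%:E <= 0%E :> \bar R)%E by exact: cvge_ge h sup0.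
  by move: h10; rewrite leNgt lte01.
apply: nearW => n; apply: ereal_sup_ubound; exists (a n) => //.
rewrite -(synthesis_unit n hE Scvg) WS.
by rewrite /= eqxx scalar_abs1.
Qed.

(** The sums c_0 chi_0 + ... + c_(n-1) chi_(n-1) with |c_i| <= 1 are pointwise
    bounded by the l_1-norms of the sequences (chi_i(x)), hence equicontinuous since
    E is barrelled.  Choosing for c the conjugate signs of the chi_i(y) turns
    equicontinuity at 0 into a bound of these norms near 0. *)
Lemma barrelled_l1_map (E : tvsType K) (chi : nat -> E -> K^o) :
  barrelled E -> (forall n, topological_dual E (chi n)) ->
  forall s : (forall x, abs_summable (fun n => chi n x)),
  continuous_linear E L (fun x => l1_of (s x)).
Proof.
move=> bE dchi s; have lT : linear (fun x => l1_of (s x)).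
  by move=> k u v; apply: l1_ext => n; exact: ((dchi n).1 k u v).
split => //; pose T x : L := l1_of (s x).
pose B := [set f : E -> K^o | exists n (c : nat -> K),
  (forall i, scalar_abs (c i) <= 1) /\
  f = fun x => \sum_(0 <= i < n) c i * chi i x].
have BT f x : B f -> scalar_abs (f x) <= l1_nrm (T x).
  move=> [n [c [c1 ->]]]; apply: le_trans (scalar_abs_sum _ _ _) _.
  apply: le_trans (l1_psum_le (T x) n); apply: ler_sum => i _.
  by rewrite scalar_absM ler_piMl // scalar_abs_ge0.
have Bdual : B `<=` topological_dual E.
  move=> _ [n [c [_ ->]]]; elim: n => [|n [lf cf]].
    rewrite (_ : (fun _ => _) = cst 0); last first.
      by apply/funext => x; rewrite big_geq.
    by split; [move=> k u v; rewrite /= scaler0 addr0|exact: cst_continuous].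
  have -> : (fun x => \sum_(0 <= i < n.+1) c i * chi i x) =
      (fun x => (\sum_(0 <= i < n) c i * chi i x : K^o) + c n *: chi n x).
    by apply/funext => x; rewrite big_nat_recr.
  have [lchi cchi] := dchi n; split.
    move=> k u v /=; rewrite lf lchi !scalerDr addrACA !scalerA.
    by rewrite [k * _]mulrC.
  move=> x; apply: (@cvgD _ K^o); first exact: cf.
  by apply: (@cvgZr _ K^o); exact: cchi.
have Bbounded : weak_star_bounded B.
  move=> U [xs [e [e0 eU]]].
  pose M := \sum_(x <- xs) l1_nrm (T x).
  have M0 : 0 <= M by apply: sumr_ge0 => x _; exact: l1_nrm_ge0.
  have [r r0 eE] := gt0_scalarP e0.
  have s0 : 0 < (M + 1) / r by rewrite divr_gt0 // ltr_wpDl.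
  exists (scalar_of_real F ((M + 1) / r)); first by rewrite scalar_gt0.
  move=> t st f Bf; have t0 : 0 < t by apply: lt_trans st; rewrite scalar_gt0.
  exists (t^-1 *: f); last by rewrite scalerA mulfV ?gt_eqF // scale1r.
  apply: eU => x xxs /=; rewrite -[X in `|X|]/(t^-1 * f x) normr_scalar eE ltr_scalar.
  have [q q0 tE] := gt0_scalarP t0.
  have tV : scalar_abs t^-1 = q^-1.
    by rewrite tE -fmorphV scalar_abs_of_real gtr0_norm ?invr_gt0.
  have st' : M + 1 < q * r.
    by rewrite -ltr_pdivrMr // -(ltr_scalar (F := F)) -tE.
  rewrite scalar_absM tV mulrC ltr_pdivrMr // mulrC.
  apply: le_lt_trans st'.
  apply: (@le_trans _ _ M); last by rewrite lerDl.
  apply: le_trans (BT f x Bf) _; rewrite /M (big_rem x) //= lerDl.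
  by apply: sumr_ge0 => z _; exact: l1_nrm_ge0.
have equi := bE B Bdual Bbounded.
have T1 : \forall y \near (0 : E), l1_nrm (T y) <= 1.
  have equi0 : \forall y \near (0 : E), forall f, B f ->
      ball (f 0 : K^o) (1 : K) (f y).
    exact: equi 0 _ (entourage_ball (K^o : pseudoMetricType K) 1%:pos).
  apply: filterS equi0 => y By; apply: l1_nrm_le => n.
  pose c i := if chi i y == 0 then 0 else `|chi i y| / chi i y.
  pose f x := \sum_(0 <= i < n) c i * chi i x.
  have Bf : B f.
    exists n, c; split => // i; rewrite /c; have [_|ne0] := eqVneq.
      by rewrite scalar_abs0.
    rewrite scalar_absM scalar_abs_norm -scalar_absM mulfV //.
    by rewrite scalar_abs1.
  have := By f Bf; rewrite -ball_normE /=.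
  have -> : f 0 = 0.
    rewrite /f big1 // => i _; have [g gE] := linear_pack (dchi i).1.
    by rewrite gE linear0 mulr0.
  have -> : f y = scalar_of_real F (\sum_(0 <= i < n) scalar_abs (chi i y)).
    rewrite /f rmorph_sum; apply: eq_bigr => i _; rewrite /c.
    have [->|ne0] := eqVneq (chi i y) 0; first by rewrite mul0r scalar_abs0 rmorph0.
    by rewrite divfK // normr_scalar.
  rewrite sub0r normrN normr_scalar scalar_abs_of_real.
  rewrite -[X in _ < X](rmorph1 (scalar_of_real F)) ltr_scalar => /ltW.
  by apply: le_trans; exact: ler_norm.
apply: linear_continuous_at0 => // U /l1_nbhs0P[r r0 rU].
have r2 : scalar_of_real F (r / 2) != 0.
  by rewrite fmorph_eq0 mulf_neq0 ?invr_eq0 ?pnatr_eq0 // gt_eqF.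
apply: filterS (nbhs0Z r2 T1) => _ [y /= y1 <-]; apply: rU.
have [g gE] := linear_pack lT.
rewrite -[l1_of _]/((fun x => l1_of (s x)) _) gE linearZ -gE l1_nrmZ.
rewrite scalar_abs_of_real gtr0_norm ?divr_gt0 //.
by have := y1; rewrite /T; nra.
Qed.

Lemma barrelled_coarse_one_infty (E : tvsType K) (A : set E) :
  A !=set0 -> barrelled E -> coarse_1_limited A -> one_infty_limited A.
Proof.
move=> [a0 Aa0] bE cA chi dchi s.
have pA := cA _ (barrelled_l1_map bE dchi s).
have small (e : R) : 0 < e -> \forall n \near \oo, forall a, A a ->
    scalar_abs (chi n a) < e.
  move=> e0; have := precompact_coord e0 pA; apply: filterS => n h a Aa.
  by apply: (h (l1_of (s a))); exists a.
pose g n := ereal_sup [set (scalar_abs (chi n a))%:E | a in A].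
have g_ge0 n : (0 <= g n)%E.
  apply: le_trans (_ : ((scalar_abs (chi n a0))%:E <= _)%E).
    by rewrite lee_fin scalar_abs_ge0.
  by apply: ereal_sup_ubound; exists a0.
have g_le (e : R) : 0 < e -> \forall n \near \oo, (g n <= e%:E)%E.
  move=> /small; apply: filterS => n h; apply: ge_ereal_sup => _ [a Aa <-].
  by rewrite lee_fin ltW // h.
apply/fine_cvgP; split.
  apply: filterS (g_le 1 ltr01) => n g1.
  by rewrite ge0_fin_numE ?g_ge0 //; exact: le_lt_trans g1 (ltry _).
apply/cvgrPdist_le => e /g_le; apply: filterS => n ge.
have gfin : g n \is a fin_num.
  by rewrite ge0_fin_numE ?g_ge0 //; exact: le_lt_trans ge (ltry _).
rewrite sub0r normrN ger0_norm ?fine_ge0 ?g_ge0 //.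
by rewrite -lee_fin fineK.
Qed.

End coarse_limited_sets.

Theorem theorem5p15 (R : realType) (F : scalar_kind) (E : tvsType (scalars R F))
  (hausdorffE : hausdorff_space E)
  (locally_completeE : locally_complete E)
  (separable_bounded_metrizable : forall B : set E,
     tvs_bounded B -> separable (set_type B) -> metrizable R (set_type B))
  (A : set E) (A_nonempty : A !=set0) (A_bounded : tvs_bounded A) :
  let i := coarse_1_limited A in
  let ii := ~ exists x : nat -> E,
    [/\ forall n, A (x n), l1_sequence x & complemented (closed_span (range x))] in
  let iii := one_infty_limited A in
  (i <-> ii) /\ (barrelled E -> (i <-> iii) /\ (ii <-> iii)).
Proof.
move=> i ii iii.
have i_ii : i <-> ii.
  split => [cA [x [Ax l1x cx]]|noseq]; first exact: coarse_1_limited_no_l1 cA Ax l1x cx.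
  apply: contrapT.
  move=> /(not_coarse_1_limited hausdorffE locally_completeE A_bounded).
  move=> [x [Ax [S [W [cS cW Scvg WS]]]]]; apply: noseq; exists x.
  by have [] := l1_section_complemented hausdorffE cS cW Scvg WS.
split=> // bE; suff i_iii : i <-> iii by split => //; rewrite -i_ii.
split; first exact: barrelled_coarse_one_infty.
exact: one_infty_limited_coarse.
Qed.
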